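(* Let $k$ be an algebraically closed field, and let $S$ be an integral domain which is a finitely generated $k$-algebra. Let $I$ be a nonzero radical ideal of $S$ such that $\operatorname{dim}S/I \geq 1$, and set $R := k + I$. If $S$ is a unique factorization domain or $\operatorname{ht}_S(I) = 1$, then $S$ is a saturated depiction of $R$.
   Context: All algebras are commutative integral domains over the algebraically closed field $k$; $\dim$ is Krull dimension. $R=k+I$ is the subalgebra of $S$ consisting of sums of scalars and elements of $I$. For a $k$-algebra domain $S$ containing $R$ as a subalgebra, set $$U_{S/R} := \{ \mathfrak{n} \in \operatorname{Max}S \mid R_{\mathfrak{n}\cap R} = S_{\mathfrak{n}} \}.$$ Depiction: Let $S$ be an integral domain that is a finitely generated $k$-algebra and contains $R$ as a subalgebra. $S$ is a depiction of $R$ if the map $\iota_{S/R}:\operatorname{Spec}S \to \operatorname{Spec}R$, $\mathfrak{q} \mapsto \mathfrak{q}\cap R$, is surjective, and $$U_{S/R} = \{ \mathfrak{n} \in \operatorname{Max}S \mid R_{\mathfrak{n}\cap R} \text{ is noetherian} \} \neq \emptyset.$$ Geometric height: for $\mathfrak{p}\in\operatorname{Spec}R$, $$\operatorname{ght}_R(\mathfrak{p}) := \min\{ \operatorname{ht}_{S'}(\mathfrak{q}) \mid \mathfrak{q} \in \iota_{S'/R}^{-1}(\mathfrak{p}),\ S' \text{ a depiction of } R\}.$$ Saturated: a depiction $S$ of $R$ is saturated if for each $\mathfrak{p} \in \operatorname{Spec}R$ there is some $\mathfrak{q} \in \iota_{S/R}^{-1}(\mathfrak{p})$ such that $\operatorname{ght}_R(\mathfrak{p})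 = \operatorname{ht}_S(\mathfrak{q})$. The height $\operatorname{ht}_S(I)$ of an ideal $I$ is the minimum of the heights of the primes containing $I$. *)

(* Defs.v *)
From HB Require Import structures.
From mathcomp Require Import all_boot all_algebra.
From mathcomp Require Import generic_quotient ring_quotient fraction.
From mathcomp Require Import boolp classical_sets.

Set Implicit Arguments.
Unset Strict Implicit.
Unset Printing Implicit Defensive.

Import GRing.Theory.
Local Open Scope classical_set_scope.
Local Open Scope ring_scope.

#[short(type="idomainAlgType")]
HB.structure Definition IdomainAlgebra (R : pzRingType) :=
  {A of GRing.IntegralDomain A & GRing.Algebra R A}.

(** Ideals are the library's [idealr] and [prime_idealr]: boolean predicates
    (classically, arbitrary subsets), always proper.  [prime_idealr A] plays
    the role of Spec A; two ideals are compared as sets, with [=i]. *)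

Definition radical_ideal (A : comNzRingType) (I : idealr A) : Prop :=
  forall (x : A) (n : nat), x ^+ n \in (I : pred A) -> x \in (I : pred A).

Definition nonzero_ideal (A : comNzRingType) (I : idealr A) : Prop :=
  exists2 x : A, x \in (I : pred A) & x != 0.

Definition maximal_ideal (A : comNzRingType) (n : prime_idealr A) : Prop :=
  forall J : idealr A, {subset (n : pred A) <= (J : pred A)} ->
    (J : pred A) =i (n : pred A).

(** Every ideal is finitely generated; the unit ideal, which is not an
    [idealr], is generated by 1. *)
Definition noetherian (A : comNzRingType) : Prop :=
  forall J : idealr A, exists s : seq A, forall x : A,
    x \in (J : pred A) <->
    exists c : 'I_(size s) -> A, x = \sum_(i < size s) c i * s`_i.

(** Only the values of [P] at 0, ..., n matter. *)
Definition prime_chain (A : comNzRingType) (P : nat -> prime_idealr A)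
    (n : nat) : Prop :=
  forall i : nat, (i < n)%N ->
    {subset (P i : pred A) <= (P i.+1 : pred A)} /\
    ~ {subset (P i.+1 : pred A) <= (P i : pred A)}.

Definition krull_dim_ge (A : comNzRingType) (n : nat) : Prop :=
  exists P : nat -> prime_idealr A, prime_chain P n.

Definition height_ge (A : comNzRingType) (q : prime_idealr A) (n : nat) :
    Prop :=
  exists P : nat -> prime_idealr A,
    prime_chain P n /\ (P n : pred A) =i (q : pred A).

(** [height_is q n] says ht(q) = n; no [n] qualifies when ht(q) is infinite,
    which never happens in a finitely generated algebra over a field. *)
Definition height_is (A : comNzRingType) (q : prime_idealr A) (n : nat) :
    Prop :=
  height_ge q n /\ ~ height_ge q n.+1.

Definition is_min (X : set nat) (n : nat) : Prop :=
  X n /\ forall m : nat, X m -> (n <= m)%N.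

Definition ideal_height_is (A : comNzRingType) (I : idealr A) (n : nat) :
    Prop :=
  is_min [set m | exists q : prime_idealr A,
            {subset (I : pred A) <= (q : pred A)} /\ height_is q m] n.

Definition fin_gen_algebra (k : fieldType) (A : idomainAlgType k) : Prop :=
  exists s : seq A, forall B : {pred A},
    subalg_closed B -> {subset s <= B} -> forall x : A, x \in B.

Definition irreducible_elt (A : idomainType) (x : A) : Prop :=
  [/\ x != 0, x \isn't a GRing.unit &
      forall a b : A, x = a * b -> a \is a GRing.unit \/ b \is a GRing.unit].

Definition associates (A : idomainType) (x y : A) : Prop :=
  exists2 u : A, u \is a GRing.unit & x = u * y.

Definition ufd (A : idomainType) : Prop :=
  (forall x : A, x != 0 -> x \isn't a GRing.unit ->
     exists n (a : 'I_n -> A),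
       (forall i, irreducible_elt (a i)) /\ x = \prod_(i < n) a i) /\
  (forall m n (a : 'I_m -> A) (b : 'I_n -> A),
     (forall i, irreducible_elt (a i)) -> (forall j, irreducible_elt (b j)) ->
     \prod_(i < m) a i = \prod_(j < n) b j ->
     exists f : 'I_m -> 'I_n,
       bijective f /\ forall i, associates (a i) (b (f i))).

Section Contraction.
Variables (A B : comNzRingType) (f : {rmorphism A -> B}) (q : prime_idealr B).

Definition contraction : pred A := fun x => f x \in (q : pred B).

Lemma contractionE x : (x \in contraction) = (f x \in (q : pred B)).
Proof. by []. Qed.

Lemma contraction_idealr_closed : idealr_closed contraction.
Proof.
split.
- by rewrite contractionE rmorph0 idealr0.
- by rewrite contractionE rmorph1 idealr1.
move=> a x y; rewrite !contractionE => qx qy.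
by rewrite rmorphD rmorphM rpredD // idealMr.
Qed.

Lemma contraction_prime : prime_idealr_closed contraction.
Proof. by move=> x y; rewrite !contractionE rmorphM prime_idealrM. Qed.

HB.instance Definition _ := isIdealr.Build A contraction
  contraction_idealr_closed.
HB.instance Definition _ := isPrimeIdealrClosed.Build A contraction
  contraction_prime.

End Contraction.

Definition lies_over (A B : comNzRingType) (f : {rmorphism A -> B})
    (q : prime_idealr B) (p : prime_idealr A) : Prop :=
  contraction f q =i (p : pred A).

Section Localization.
Variables (A : idomainType) (p : prime_idealr A).
Local Notation "x %:F" := (@FracField.tofrac A x).

Definition local_pred : pred {fraction A} := fun z =>
  `[< exists a b : A, b \notin (p : pred A) /\ z = a%:F / b%:F >].

Lemma local_predP z : reflect
  (exists a b : A, b \notin (p : pred A) /\ z = a%:F / b%:F)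
  (z \in local_pred).
Proof. exact: asboolP. Qed.

Lemma notin_prime_neq0 b : b \notin (p : pred A) -> b%:F != 0.
Proof. by rewrite tofrac_eq0; apply: contraNneq => ->; rewrite idealr0. Qed.

Lemma local_pred_subring_closed : subring_closed local_pred.
Proof.
split.
- apply/local_predP; exists 1, 1; rewrite idealr1; split=> //.
  by rewrite divr1.
- move=> _ _ /local_predP[a [b [pb ->]]] /local_predP[c [d [pd ->]]].
  apply/local_predP; exists (a * d - c * b), (b * d).
  rewrite prime_idealrM negb_or pb pd; split=> //.
  by rewrite -mulNr addf_div ?notin_prime_neq0 // rmorphB !rmorphM mulNr.
- move=> _ _ /local_predP[a [b [pb ->]]] /local_predP[c [d [pd ->]]].
  apply/local_predP; exists (a * c), (b * d).
  by rewrite prime_idealrM negb_or pb pd mulf_div !rmorphM.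
Qed.

HB.instance Definition _ := GRing.isSubringClosed.Build {fraction A} local_pred
  local_pred_subring_closed.

Record localization := Localization {
  localization_val :> {fraction A};
  _ : localization_val \in local_pred }.

HB.instance Definition _ := [isSub for localization_val].
HB.instance Definition _ := [Choice of localization by <:].
HB.instance Definition _ :=
  [SubChoice_isSubComNzRing of localization by <:].

End Localization.

(** An overring S of R is given by an injective algebra morphism
    [iota : R -> S].

    The equality of R_{n /\ R} and S_n as subrings of Frac S; the elements of
    R_{n /\ R} are the fractions of elements of R with denominator outside
    [contraction iota n]. *)
Definition same_localization (R S : idomainType) (iota : {rmorphism R -> S})
    (n : prime_idealr S) : Prop :=
  forall z : {fraction S},
    (exists a b : R, b \notin (contraction iota n : pred R) /\
       z = FracField.tofrac (iota a) / FracField.tofrac (iota b)) <->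
    z \in local_pred n.

Definition U_locus (R S : idomainType) (iota : {rmorphism R -> S}) :
    set (prime_idealr S) :=
  [set n | maximal_ideal n /\ same_localization iota n].

Definition noetherian_locus (R S : idomainType) (iota : {rmorphism R -> S}) :
    set (prime_idealr S) :=
  [set n | maximal_ideal n /\ noetherian (localization (contraction iota n))].

Definition spec_surjective (R S : idomainType) (iota : {rmorphism R -> S}) :
    Prop :=
  forall p : prime_idealr R, exists q : prime_idealr S, lies_over iota q p.

Definition depiction (k : fieldType) (R S : idomainAlgType k)
    (iota : {lrmorphism R -> S}) : Prop :=
  [/\ injective iota,
      fin_gen_algebra S,
      spec_surjective iota,
      U_locus iota = noetherian_locus iota &
      noetherian_locus iota !=set0].

Definition geom_height_is (k : fieldType) (R : idomainAlgType k)
    (p : prime_idealr R) (n : nat) : Prop :=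
  is_min [set m | exists (S : idomainAlgType k) (iota : {lrmorphism R -> S})
                         (q : prime_idealr S),
            [/\ depiction iota, lies_over iota q p & height_is q m]] n.

Definition saturated_depiction (k : fieldType) (R S : idomainAlgType k)
    (iota : {lrmorphism R -> S}) : Prop :=
  depiction iota /\
  forall p : prime_idealr R, exists (q : prime_idealr S) (n : nat),
    [/\ lies_over iota q p, geom_height_is p n & height_is q n].

Section KPlus.
Variables (k : fieldType) (S : idomainAlgType k) (I : idealr S).

Definition kplus_pred : pred S := fun x =>
  `[< exists (c : k) (y : S), y \in (I : pred S) /\ x = c%:A + y >].

Lemma kplus_predP x : reflect
  (exists (c : k) (y : S), y \in (I : pred S) /\ x = c%:A + y)
  (x \in kplus_pred).
Proof. exact: asboolP. Qed.

Lemma kplus_subalg_closed : subalg_closed kplus_pred.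
Proof.
split.
- by apply/kplus_predP; exists 1, 0; rewrite idealr0 scale1r addr0.
- move=> a _ _ /kplus_predP[c [y [Iy ->]]] /kplus_predP[d [z [Iz ->]]].
  apply/kplus_predP; exists (a * c + d), (a *: y + z); split.
    by rewrite rpredD // -mulr_algl idealMr.
  by rewrite scalerDr scalerA scalerDl addrACA.
- move=> _ _ /kplus_predP[c [y [Iy ->]]] /kplus_predP[d [z [Iz ->]]].
  apply/kplus_predP; exists (c * d), (c%:A * z + (d%:A + z) * y); split.
    by rewrite rpredD // idealMr.
  by rewrite mulrDl mulrDr -scalerAl mul1r scalerA -addrA [y * _]mulrC.
Qed.

HB.instance Definition _ :=
  GRing.isSubalgClosed.Build k S kplus_pred kplus_subalg_closed.

Record kplus := KPlus { kplus_val :> S; _ : kplus_val \in kplus_pred }.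

HB.instance Definition _ := [isSub for kplus_val].
HB.instance Definition _ := [Choice of kplus by <:].
HB.instance Definition _ := [SubChoice_isSubComNzRing of kplus by <:].
HB.instance Definition _ := [SubZmodule_isSubLmodule of kplus by <:].
HB.instance Definition _ :=
  [SubNzRing_SubLmodule_isSubLalgebra of kplus by <:].
HB.instance Definition _ := [SubLalgebra_isSubAlgebra of kplus by <:].

(** A subalgebra is not assumed closed under inversion in S, so the inverse in
    k + I is chosen classically. *)
Definition kplus_unit : pred kplus := fun x => `[< exists y, y * x = 1 >].

Definition kplus_inv (x : kplus) : kplus :=
  if pselect (exists y, y * x = 1) is left e then sval (cid e) else x.

Lemma kplus_mulVx : {in kplus_unit, left_inverse 1 kplus_inv *%R}.
Proof.
move=> x /asboolP ex; rewrite /kplus_inv; case: pselect => // e.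
exact: svalP (cid e).
Qed.

Lemma kplus_unitP (x y : kplus) : y * x = 1 -> kplus_unit x.
Proof. by move=> yx; apply/asboolP; exists y. Qed.

Lemma kplus_inv_out : {in [predC kplus_unit], kplus_inv =1 id}.
Proof.
move=> x /asboolPn nex; rewrite /kplus_inv.
by case: pselect => // e; case: (nex e).
Qed.

HB.instance Definition _ := GRing.ComNzRing_hasMulInverse.Build kplus
  kplus_mulVx kplus_unitP kplus_inv_out.

Lemma kplus_integral : GRing.integral_domain_axiom kplus.
Proof.
move=> x y /(congr1 val)/eqP; rewrite rmorphM rmorph0 mulf_eq0.
by rewrite -!(inj_eq val_inj) rmorph0.
Qed.

HB.instance Definition _ := GRing.ComUnitRing_isIntegral.Build kplus
  kplus_integral.

Definition kplus_incl (x : kplus) : S := val x.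

HB.instance Definition _ := GRing.RMorphism.copy kplus_incl (val : kplus -> S).
HB.instance Definition _ := GRing.Linear.copy kplus_incl (val : kplus -> S).

End KPlus.

Arguments kplus_incl {k S} I x.

(* Main.v *)
(** For [p <> I] in Spec R, pick [r0] in [I] outside [p]: since [r0 S] lies in
    [R], the local ring [R_p] is noetherian and equals [S_q] for the unique [q]
    over [p].  The Nullstellensatz turns the equality of the loci in the
    definition of a depiction S' into [S'_q' = R_p] for every [q'] over [p], so
    all the heights over [p] agree.

    For [p = I], every [q'] over [I] is nonzero, which settles the case where a
    height-one prime of S contains [I].  Otherwise S is a UFD and [I] lies in no
    height-one prime, so S' is contained in all the localizations of S at
    height-one primes, hence in S.  As [I] is a nonzero common ideal, S is
    integral over the noetherian ring S', and lying over and incomparability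
    compare the heights.

    S is a depiction because [R_I] is not noetherian: otherwise S/I would be
    algebraic over k, hence of dimension 0.

    Hilbert's basis theorem, the Nullstellensatz and the finiteness of the
    dimension are transferred from B to B[X] for a domain B. *)

Require Import Defs.
From HB Require Import structures.
From mathcomp Require Import all_boot all_algebra.
From mathcomp Require Import generic_quotient ring_quotient fraction.
From mathcomp Require Import boolp classical_sets.

Set Implicit Arguments.
Unset Strict Implicit.
Unset Printing Implicit Defensive.

Import GRing.Theory.
Local Open Scope ring_scope.

(** * Noetherian rings *)

Lemma exists_min (P : nat -> Prop) : (exists n, P n) -> exists n, is_min P n.
Proof.
case=> n Pn; have exP : exists n, `[< P n >] by exists n; apply/asboolP.
case: (ex_minnP exP) => m /asboolP Pm m_min; exists m; split=> // j Pj.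
by apply/m_min/asboolP.
Qed.

(** Unlike [idealr], this admits the unit ideal, so that ideals built inside a proof need no check
    of properness. *)
Definition ideal_like (A : comNzRingType) (P : A -> Prop) : Prop :=
  P 0 /\ forall a x y, P x -> P y -> P (a * x + y).

Section IdealLike.
Variable A : comNzRingType.
Implicit Types (P : A -> Prop) (J : idealr A).

Lemma idealr_ideal_like J : ideal_like (fun x => x \in (J : pred A)).
Proof. by split=> [|a x y Jx Jy]; rewrite ?idealr0 ?rpredD ?idealMr. Qed.

Lemma ideal_like_idealr P : ideal_like P -> ~ P 1 ->
  exists J : idealr A, forall x, x \in (J : pred A) <-> P x.
Proof.
move=> [P0 Plin] P1.
have cl : idealr_closed (fun x => `[< P x >] : bool).
  split; first exact/asboolP.
    by apply/negP => /asboolP.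
  by move=> a x y /asboolP Px /asboolP Py; apply/asboolP/Plin.
exists (HB.pack_for (idealr A) (fun x => `[< P x >] : bool)
  (isIdealr.Build A _ cl)) => x.
by split=> [/asboolP|?] //; apply/asboolP.
Qed.

Lemma ideal_like_prime P : ideal_like P -> ~ P 1 ->
  (forall x y, P (x * y) -> P x \/ P y) ->
  exists q : prime_idealr A, forall x, x \in (q : pred A) <-> P x.
Proof.
move=> [P0 Plin] P1 Pprime.
have cl : idealr_closed (fun x => `[< P x >] : bool).
  split; first exact/asboolP.
    by apply/negP => /asboolP.
  by move=> a x y /asboolP Px /asboolP Py; apply/asboolP/Plin.
have pr : prime_idealr_closed (fun x => `[< P x >] : bool).
  by move=> x y /asboolP/Pprime[]H; apply/orP; [left|right]; apply/asboolP.
exists (HB.pack_for (prime_idealr A) (fun x => `[< P x >] : bool)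
  (isIdealr.Build A _ cl) (isPrimeIdealrClosed.Build A _ pr)) => x.
by split=> [/asboolP|?] //; apply/asboolP.
Qed.

Lemma ideal_likeM P a x : ideal_like P -> P x -> P (a * x).
Proof. by case=> P0 Plin Px; rewrite -[a * x]addr0; apply: Plin. Qed.

Lemma ideal_likeD P x y : ideal_like P -> P x -> P y -> P (x + y).
Proof. by case=> P0 Plin Px Py; rewrite -[x]mul1r; apply: Plin. Qed.

Lemma ideal_like_sum P (I : finType) (F : I -> A) :
  ideal_like P -> (forall i, P (F i)) -> P (\sum_i F i).
Proof.
by move=> idP PF; elim/big_ind: _ => // [|x y];
  [case: idP | apply: ideal_likeD].
Qed.

Definition span (s : seq A) (x : A) : Prop :=
  exists c : 'I_(size s) -> A, x = \sum_(i < size s) c i * s`_i.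

Lemma span_ideal_like s : ideal_like (span s).
Proof.
split; first by exists (fun=> 0); rewrite big1 // => i _; rewrite mul0r.
move=> a _ _ [c ->] [d ->]; exists (fun i => a * c i + d i).
rewrite mulr_sumr -big_split; apply: eq_bigr => i _ /=.
by rewrite mulrDl mulrA.
Qed.

Lemma mem_span s x : x \in s -> span s x.
Proof.
move=> sx; have lt_i : (index x s < size s)%N by rewrite index_mem.
exists (fun i => (i == Ordinal lt_i)%:R).
rewrite (bigD1 (Ordinal lt_i)) //= eqxx mul1r nth_index // big1 ?addr0 //.
by move=> i /negPf ->; rewrite mul0r.
Qed.

Lemma span_sub s P : ideal_like P -> (forall x, x \in s -> P x) ->
  forall x, span s x -> P x.
Proof.
move=> idP sP _ [c ->]; apply: ideal_like_sum => // i.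
by apply: ideal_likeM => //; apply: sP; rewrite mem_nth.
Qed.

Lemma noetherian_fg P : noetherian A -> ideal_like P ->
  exists s : seq A, (forall x, x \in s -> P x) /\ (forall x, P x -> span s x).
Proof.
move=> noethA idP; case: (pselect (P 1)) => [P1|nP1].
  exists [:: 1]; split=> [x|x _]; first by rewrite inE => /eqP ->.
  rewrite -[x]mulr1; apply: ideal_likeM; first exact: span_ideal_like.
  by apply: mem_span; rewrite inE.
have [J JP] := ideal_like_idealr idP nP1.
have [s sJ] := noethA J; exists s; split=> [x sx|x Px].
  by apply/JP/sJ/mem_span.
exact/sJ/JP.
Qed.

Lemma fg_noetherian :
  (forall J, exists s : seq A, (forall x, x \in s -> x \in (J : pred A)) /\
     (forall x, x \in (J : pred A) -> span s x)) -> noetherian A.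
Proof.
move=> fgA J; have [s [sJ Js]] := fgA J; exists s => x; split=> [/Js //|].
exact: (span_sub (idealr_ideal_like J) sJ).
Qed.

(** The union of the chain is an ideal, and its finitely many generators already lie in one of the
    [K d]. *)
Lemma noetherian_acc (K : nat -> A -> Prop) : noetherian A ->
  (forall d, ideal_like (K d)) -> (forall d x, K d x -> K d.+1 x) ->
  exists d, forall e x, K e x -> K d x.
Proof.
move=> noethA idK K1.
have Kle d e x : (d <= e)%N -> K d x -> K e x.
  by move=> /subnK <-; elim: (e - d)%N => // n IH /IH; apply: K1.
have idU : ideal_like (fun x => exists d, K d x).
  split=> [|a x y [d Kx] [e Ky]]; first by exists 0%N; case: (idK 0%N).
  exists (maxn d e); case: (idK (maxn d e)) => _; apply.
    by apply: Kle Kx; rewrite leq_maxl.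
  by apply: Kle Ky; rewrite leq_maxr.
have [s [sU Us]] := noetherian_fg noethA idU.
have [d Kd] : exists d, forall x, x \in s -> K d x.
  elim: s sU {Us} => [|y s IH] sU; first by exists 0%N.
  have [x sx|d Kd] := IH; first by apply: sU; rewrite inE sx orbT.
  have [e Ky] := sU y (mem_head _ _); exists (maxn d e) => x.
  rewrite inE => /predU1P[->|/Kd]; first by apply: Kle Ky; rewrite leq_maxr.
  by apply: Kle; rewrite leq_maxl.
by exists d => e x Kx; apply: (span_sub _ Kd) => //; apply: Us; exists e.
Qed.

End IdealLike.

Lemma noetherian_image (A B : comNzRingType) (f : {rmorphism A -> B}) :
  (forall y, exists x, f x = y) -> noetherian A -> noetherian B.
Proof.
move=> f_surj noethA; apply: fg_noetherian => J.
have idP : ideal_like (fun x => f x \in (J : pred B)).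
  split=> [|a x y Jx Jy]; first by rewrite rmorph0 idealr0.
  by rewrite rmorphD rmorphM rpredD ?idealMr.
have [s [sJ Js]] := noetherian_fg noethA idP.
exists (map f s); split=> [_ /mapP[x /sJ ? ->] //|y Jy].
have [x fx] := f_surj y; rewrite -fx in Jy *.
apply: (@span_sub _ s (fun x => span (map f s) (f x))) (Js _ Jy).
  have [sp0 spl] := span_ideal_like (map f s).
  by split=> [|a u v ? ?]; rewrite ?rmorph0 ?rmorphD ?rmorphM //; apply: spl.
by move=> u su; apply/mem_span/map_f.
Qed.

Lemma noetherian_field (k : fieldType) : noetherian k.
Proof.
apply: fg_noetherian => J; exists [::]; split=> // x Jx.
have [->|x_neq0] := eqVneq x 0; first by case: (span_ideal_like (Nil k)).
by have := idealMr x^-1 Jx; rewrite mulVf // idealr1.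
Qed.

Lemma size_poly_drop (B : nzRingType) (p : {poly B}) m :
  (size p <= m.+1)%N -> p`_m = 0 -> (size p <= m)%N.
Proof.
move=> sp pm; apply/leq_sizeP => j; rewrite leq_eqVlt => /predU1P[<- //|lt_mj].
by apply: nth_default; apply: leq_trans lt_mj.
Qed.

(** * Hilbert's basis theorem *)

Section HilbertBasis.
Variables (B : comNzRingType) (J : idealr {poly B}).
Hypothesis noethB : noetherian B.

(** The leading coefficients of the members of [J] of degree [d]; admitting lower degrees adds 0 and
    makes [L d] an ideal. *)
Let L d b := exists p : {poly B},
  [/\ p \in (J : pred _), (size p <= d.+1)%N & p`_d = b].

Let L_ideal d : ideal_like (L d).
Proof.
split; first by exists 0; rewrite idealr0 size_poly0 coef0.
move=> a _ _ [p [Jp sp <-]] [q [Jq sq <-]]; exists (a%:P * p + q).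
rewrite rpredD ?idealMr ?coefD ?coefCM //; split=> //.
rewrite (leq_trans (size_polyD _ _)) // geq_max sq mul_polyC.
by rewrite (leq_trans (size_scale_leq _ _)).
Qed.

Let L_incr d b : L d b -> L d.+1 b.
Proof.
move=> [p [Jp sp <-]]; exists (p * 'X); rewrite mulrC idealMr // mulrC coefMX.
split=> //; have [->|p0] := eqVneq p 0; first by rewrite mul0r size_poly0.
by rewrite size_mulX.
Qed.

Let fg_below m : exists s : seq {poly B},
  (forall x, x \in s -> x \in (J : pred _)) /\
  (forall p, p \in (J : pred _) -> (size p <= m)%N -> span s p).
Proof.
elim: m => [|m [s [sJ Js]]].
  exists [::]; split=> // p _; rewrite leqn0 size_poly_eq0 => /eqP ->.
  by case: (span_ideal_like (Nil {poly B})).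
have [bs [bsL Lbs]] := noetherian_fg noethB (L_ideal m).
have [t [tJ tbs]] : exists t : seq {poly B},
    (forall x, x \in t -> x \in (J : pred _) /\ (size x <= m.+1)%N) /\
    (forall b, b \in bs -> exists2 p, p \in t & p`_m = b).
  elim: bs bsL {Lbs} => [|b bs IH] bsL; first by exists [::].
  have [x bx|t [tJ tbs]] := IH; first by apply: bsL; rewrite inE bx orbT.
  have [p [Jp sp pb]] := bsL b (mem_head _ _).
  exists (p :: t); split=> [x|x]; rewrite inE => /predU1P[->|] //.
  - exact: tJ.
  - by exists p; rewrite ?mem_head.
  - by move=> /tbs[q tq qx]; exists q; rewrite // inE tq orbT.
have idst := span_ideal_like (s ++ t).
have sub_st (x : {poly B}) : span s x -> span (s ++ t) x.
  by apply: span_sub => // y sy; apply: mem_span; rewrite mem_cat sy.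
exists (s ++ t); split=> [x|p Jp sp].
  by rewrite mem_cat => /orP[/sJ|/tJ[]].
(* The coefficient of [p] in degree [m] is a combination of [bs]; the same combination of the lifts
   in [t], subtracted from [p], lowers the size bound. *)
have [q [stq Jq sq qm]] : exists q : {poly B},
    [/\ span (s ++ t) q, q \in (J : pred _), (size q <= m.+1)%N & q`_m = p`_m].
  have : L m p`_m by exists p.
  move/Lbs; apply: (@span_sub _ bs (fun b => exists q : {poly B},
    [/\ span (s ++ t) q, q \in (J : pred _), (size q <= m.+1)%N & q`_m = b])).
    split; first by exists 0; rewrite idealr0 size_poly0 coef0; split=> //;
      case: idst.
    move=> a _ _ [u [stu Ju su <-]] [v [stv Jv sv <-]]; exists (a%:P * u + v).
    rewrite rpredD ?idealMr ?coefD ?coefCM //; split=> //;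
      first by case: idst => _; apply.
    rewrite (leq_trans (size_polyD _ _)) // geq_max sv mul_polyC.
    by rewrite (leq_trans (size_scale_leq _ _)).
  move=> b /tbs[q tq qb]; exists q; have [Jq sq] := tJ q tq.
  by split=> //; apply: mem_span; rewrite mem_cat tq orbT.
rewrite -(subrK q p); apply: ideal_likeD => //; apply/sub_st/Js.
  by rewrite rpredB.
apply: size_poly_drop; last by rewrite coefB qm subrr.
by rewrite (leq_trans (size_polyD _ _)) // geq_max sp size_polyN.
Qed.

Lemma hilbert_basis_ideal : exists s : seq {poly B},
  (forall x, x \in s -> x \in (J : pred _)) /\
  (forall p, p \in (J : pred _) -> span s p).
Proof.
have [D LD] := noetherian_acc noethB L_ideal L_incr.
have [s [sJ Js]] := fg_below D.+1; exists s; split=> // p Jp.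
have ids := span_ideal_like s.
elim: {p}(size p) {-2}p (leqnn (size p)) Jp => [|m IH] p sp Jp.
  by apply: Js => //; apply: leq_trans sp _.
have [le_mD|lt_Dm] := leqP m D; first by apply: Js => //; apply: leq_trans sp _.
(* For [m > D] the coefficient in degree [m] already occurs in [L D], so a shift of [q] by a power
   of ['X] cancels it. *)
have [q [Jq sq qp]] : L D p`_m by apply: (LD m); exists p.
rewrite -(subrK ('X^(m - D) * q) p); apply: ideal_likeD => //; last first.
  by apply: ideal_likeM => //; apply: Js.
apply: IH; last by rewrite rpredB // idealMr.
apply: size_poly_drop; last first.
  by rewrite coefB coefXnM ltnNge leq_subr /= subKn ?qp ?subrr // ltnW.
rewrite (leq_trans (size_polyD _ _)) // geq_max sp size_polyN.
rewrite (leq_trans (size_polyMleq _ _)) // size_polyXn addSn /=.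
by rewrite (leq_trans (leq_add (leqnn _) sq)) // addnS subnK // ltnW.
Qed.

End HilbertBasis.

Lemma noetherian_poly (B : comNzRingType) : noetherian B -> noetherian {poly B}.
Proof. by move=> noethB; apply: fg_noetherian => J; apply: hilbert_basis_ideal.
  Qed.

(** * Prime ideals of polynomial rings *)

Section PolyPrime.
Variables (B : idomainType) (Q : prime_idealr {poly B}).
Local Notation "p \in_Q" := (p \in (Q : pred {poly B})) (at level 70).
Local Notation "p \notin_Q" := (p \notin (Q : pred {poly B})) (at level 70).

Lemma coefs_in_prime (h : {poly B}) : (forall i, (h`_i)%:P \in_Q) -> h \in_Q.
Proof.
move=> hQ; rewrite -[h]coefK poly_def; apply: rpred_sum => i _.
by rewrite -mul_polyC mulrC idealMr.
Qed.

Lemma prime_drop_lead (h : {poly B}) : h != 0 -> (lead_coef h)%:P \in_Q ->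
  exists h' : {poly B}, [/\ (size h' < size h)%N, h - h' \in_Q &
    forall i, h'`_i = h`_i \/ (h`_i)%:P \in_Q].
Proof.
move=> h0 Qh; exists (h - lead_coef h *: 'X^((size h).-1)).
have sh : (0 < size h)%N by rewrite lt0n size_poly_eq0.
split.
- rewrite -[X in (_ < X)%N](prednK sh) ltnS; apply: size_poly_drop; last first.
    by rewrite coefB coefZ coefXn eqxx mulr1 lead_coefE subrr.
  rewrite prednK // (leq_trans (size_polyD _ _)) // geq_max leqnn size_polyN.
  by rewrite (leq_trans (size_scale_leq _ _)) // size_polyXn prednK.
- by rewrite subKr -mul_polyC mulrC idealMr.
- move=> i; rewrite coefB coefZ coefXn; case: eqP => [->|_].
    by right; rewrite -lead_coefE.
  by left; rewrite mulr0 subr0.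
Qed.

(** Leading terms with coefficient in [Q] are dropped one by one; the coefficient of index [i] is
    never dropped, so the process stops before reaching 0. *)
Lemma prime_lead_notin (h : {poly B}) i : h \in_Q -> (h`_i)%:P \notin_Q ->
  exists2 p : {poly B}, p \in_Q &
    (lead_coef p)%:P \notin_Q /\ (size p <= size h)%N.
Proof.
move: {2}(size h) (leqnn (size h)) => m.
elim: m h => [|m IH] h sh Qh Qi.
  move: sh Qi; rewrite leqn0 size_poly_eq0 => /eqP ->.
  by rewrite coef0 idealr0.
case: (boolP ((lead_coef h)%:P \in_Q)) => Ql; last by exists h.
have h0 : h != 0 by apply: contraNneq Qi => ->; rewrite coef0 idealr0.
have [h' [sh' Qhh' ch']] := prime_drop_lead h0 Ql.
have [|||p Qp [Qlp sp]] := IH h'.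
- by rewrite -ltnS (leq_trans sh').
- by rewrite -(subKr h h') rpredB.
- by case: (ch' i) => [->|Qi'] //; rewrite Qi' in Qi.
by exists p => //; split=> //; apply: leq_trans sp (ltnW sh').
Qed.

(** [p] has minimal size among the members of [Q] with leading coefficient outside [Q]. Over the
    fraction field of [B] modulo the contraction of [Q], it generates the ideal spanned by [Q]. *)
Lemma prime_min_poly (h : {poly B}) i : h \in_Q -> (h`_i)%:P \notin_Q ->
  exists2 p : {poly B}, p \in_Q & (lead_coef p)%:P \notin_Q /\
    forall g : {poly B}, g \in_Q -> (size g < size p)%N ->
      forall j, (g`_j)%:P \in_Q.
Proof.
move=> Qh Qi.
have [|n [[p [Qp Ql sp]] n_min]] := @exists_min (fun n => exists p : {poly B},
    [/\ p \in_Q, (lead_coef p)%:P \notin_Q & size p = n]).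
  by have [p Qp [Ql _]] := prime_lead_notin Qh Qi; exists (size p), p.
exists p => //; split=> // g Qg sg j; apply: contraTT sg => Qj.
have [p' Qp' [Ql' sp']] := prime_lead_notin Qg Qj.
by rewrite -leqNgt sp (leq_trans _ sp') // n_min //; exists p'.
Qed.

Section MinPoly.
Variable p : {poly B}.
Hypotheses (Qp : p \in_Q) (Qlp : (lead_coef p)%:P \notin_Q).
Hypothesis p_min : forall g : {poly B}, g \in_Q -> (size g < size p)%N ->
  forall j, (g`_j)%:P \in_Q.

Lemma prime_polyCX (b : B) n : b%:P \notin_Q -> (b ^+ n)%:P \notin_Q.
Proof.
move=> Qb; elim: n => [|n IH]; first by rewrite expr0 idealr1.
by rewrite exprS polyCM prime_idealrM negb_or Qb.
Qed.

(* The resultant-like element [r] comes from the Euclidean algorithm between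
   [p] and [g], over the fraction field of [B / Q :&: B]. *)
Lemma prime_poly_bezout (g : {poly B}) : g \notin_Q ->
  exists r v, r%:P \notin_Q /\ g * v - r%:P \in_Q.
Proof.
(* [h] is a multiple of [g] modulo [Q], outside [Q] and of least size; it turns out to be
   constant. *)
move=> Qg; have [|n [[h [v [Qh Qgv sh]]] n_min]] :=
    @exists_min (fun n => exists h v : {poly B},
      [/\ h \notin_Q, g * v - h \in_Q & size h = n]).
  by exists (size g), g, 1; rewrite mulr1 subrr idealr0.
have h0 : h != 0 by apply: contraNneq Qh => ->; rewrite idealr0.
have p0 : p != 0 by apply: contraNneq Qlp => ->; rewrite lead_coef0 idealr0.
have n_minN h' v' : h' \notin_Q -> g * v' - h' \in_Q -> (n <= size h')%N.
  by move=> ? ?; apply: n_min; exists h', v'.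
(* Otherwise the remainder of the pseudo-division of [h] by [p] is a smaller choice: modulo [Q] it
   is [h] times a power of [lead_coef p]. *)
have lt_hp : (size h < size p)%N.
  rewrite ltnNge; apply/negP => le_ph.
  have eq_h := Pdiv.Idomain.divp_eq h p; rewrite -mul_polyC in eq_h.
  have Qhp : h %% p \notin_Q.
    apply: contra (prime_polyCX (scalp h p) Qlp) => Qhp.
    have : (lead_coef p ^+ scalp h p)%:P * h \in_Q.
      by rewrite eq_h rpredD ?idealMr.
    by rewrite prime_idealrM (negPf Qh) orbF.
  have Qgh : g * (v * (lead_coef p ^+ scalp h p)%:P) - h %% p \in_Q.
    have -> : h %% p = (lead_coef p ^+ scalp h p)%:P * h - h %/ p * p.
      by rewrite eq_h addrC addKr.
    set c := _%:P; have -> : g * (v * c) - (c * h - h %/ p * p) =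
      c * (g * v - h) + h %/ p * p.
      by rewrite opprB addrCA [RHS]addrC mulrBr mulrA [c * (g * v)]mulrC.
    by rewrite rpredD ?idealMr.
  have := n_minN _ _ Qhp Qgh.
  by rewrite -sh leqNgt (leq_trans (ltn_modpN0 _ p0)).
have Qlh : (lead_coef h)%:P \notin_Q.
  apply/negP => Qlh; have [h' [sh' Qhh' _]] := prime_drop_lead h0 Qlh.
  suff : (n <= size h')%N by rewrite -sh leqNgt sh'.
  apply: (n_minN _ v); first by apply: contra Qh => Qh';
    rewrite -(subrK h' h) rpredD.
  by rewrite -(subrKA h) rpredD.
exists h`_0, v; suff /size1_polyC sh1 : (size h <= 1)%N by rewrite -sh1.
rewrite leqNgt; apply/negP => h_gt1.
have eq_p := Pdiv.Idomain.divp_eq p h; rewrite -mul_polyC in eq_p.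
set c := lead_coef h ^+ _ in eq_p; set w := p %/ h in eq_p.
have lt_r : (size (p %% h)%R < size h)%N by rewrite ltn_modpN0.
have Qc : c%:P \notin_Q by apply: prime_polyCX.
have c0 : c != 0 by apply: contraNneq Qc => ->; rewrite idealr0.
(* If the quotient [w] were outside [Q], the remainder of [p] by [h], congruent to [- (w * h)],
   would be a smaller choice than [h]. *)
have Qw : w \in_Q.
  case: (boolP (w \in_Q)) => // Qw.
  have eqr : p %% h = c%:P * p - w * h by rewrite eq_p addrC addKr.
  suff : (n <= size (p %% h)%R)%N by rewrite -sh leqNgt lt_r.
  apply: (n_minN _ (- (v * w))).
    apply/negP => Qr; have : w * h \in_Q.
      by rewrite -(subKr (c%:P * p) (w * h)) -eqr rpredB ?idealMr.
    by rewrite prime_idealrM (negPf Qw) (negPf Qh).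
  have -> : g * - (v * w) - p %% h = - (w * (g * v - h)) - c%:P * p.
    by rewrite eqr mulrBr !opprB mulrN addrA [- _ + _]addrC [w * (g * v)]mulrC
      -mulrA.
  by rewrite rpredB ?rpredN ?idealMr.
(* The product [w * h] has the size of [p] and a leading coefficient outside [Q]. As [h] is not
   constant, [w] is smaller than [p], so the minimality of [p] puts the coefficients of [w] in [Q],
   a contradiction. *)
have eqs : (size (w * h) = size p /\ lead_coef (w * h) = c * lead_coef p).
  have eq_wh : w * h = c *: p - p %% h by rewrite -mul_polyC eq_p addrK.
  have lt_rp : (size (- (p %% h)%R) < size (c *: p))%N.
    by rewrite size_polyN size_scale // (ltn_trans lt_r).
  by rewrite eq_wh size_polyDl // lead_coefDl // size_scale // lead_coefZ.
case: eqs => size_wh lead_wh.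
have w0 : w != 0.
  by apply: contraTneq lt_hp => w0; move: size_wh;
    rewrite w0 mul0r size_poly0 => <-.
have lt_wp : (size w < size p)%N.
  rewrite -size_wh size_mul //; case: (size h) h_gt1 => [|[|m]] // _.
  by rewrite !addnS ltnS leq_addr.
have := p_min Qw lt_wp (size w).-1; rewrite -lead_coefE => Qlw.
have : (lead_coef (w * h))%:P \notin_Q
  by rewrite lead_wh polyCM prime_idealrM negb_or Qc.
by rewrite lead_coefM polyCM prime_idealrM Qlw.
Qed.

End MinPoly.
End PolyPrime.

(** * Finitely generated algebras *)

(* Surjectivity of [psi] makes its kernel a maximal ideal. *)
Definition enough_points (k : fieldType) (B : comNzRingType) : Prop :=
  forall (Q : prime_idealr B) (b : B), b \notin (Q : pred B) ->
    exists psi : {rmorphism B -> k},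
      [/\ forall x, x \in (Q : pred B) -> psi x = 0, psi b != 0 &
          forall c, exists x, psi x = c].

Lemma enough_points_field (k : fieldType) : enough_points k k.
Proof.
move=> Q b Qb; exists idfun; split=> [x Qx||c]; last by exists c.
  apply/eqP; apply: contraTT Qx => x0; apply/negP => /(idealMr x^-1).
  by rewrite mulVf // idealr1.
by apply: contraNneq Qb => /= ->; rewrite idealr0.
Qed.

Lemma map_poly_eq0_coef (A B : nzRingType) (f : {rmorphism A -> B})
  (h : {poly A}) : (forall i, f h`_i = 0) -> map_poly f h = 0.
Proof. by move=> fh; apply/polyP => i; rewrite coef_map coef0; exact: fh. Qed.

(** A point [psi] of [B] is extended by a value [xi] of the variable. If [Q] is not extended from
    [B], then [psi] avoids the leading coefficient of the minimal [p] and the Bezout element [r],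
    and [xi] is a root of [p]; otherwise [xi] only has to avoid the roots of the image of [g]. *)
Lemma enough_points_poly (k : closedFieldType) (B : idomainType) :
  enough_points k B -> enough_points k {poly B}.
Proof.
move=> ptsB Q g Qg.
have com (psi : {rmorphism B -> k}) (xi : k) : commr_rmorph psi xi.
  by move=> x; apply: mulrC.
have surj (psi : {rmorphism B -> k}) xi : (forall c, exists x, psi x = c) ->
    forall c, exists x : {poly B}, horner_morph (com psi xi) x = c.
  by move=> psi_surj c; have [x <-] := psi_surj c; exists x%:P;
     rewrite horner_morphC.
have [[h [i [Qh Qhi]]]|nQ] := pselect (exists (h : {poly B}) i,
    h \in (Q : pred _) /\ (h`_i)%:P \notin (Q : pred {poly B})).
  have [p Qp [Qlp p_min]] := prime_min_poly Qh Qhi.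
  have [r [v [Qr Qgv]]] := prime_poly_bezout Qp Qlp p_min Qg.
  have Qlr : lead_coef p * r \notin (contraction (@polyC B) Q : pred B).
    by rewrite contractionE rmorphM prime_idealrM negb_or Qlp.
  have [psi [psiQ psi_b psi_surj]] := ptsB _ _ Qlr.
  have [psi_p psi_r] : psi (lead_coef p) != 0 /\ psi r != 0.
    by move: psi_b; rewrite rmorphM mulf_eq0 negb_or => /andP.
  (* The leading coefficient of [p] survives under [psi], and [p] is not constant, since a constant
     in [Q] would have its leading coefficient in [Q]. *)
  have /closed_rootP[xi p_xi] : size (map_poly psi p) != 1%N.
    rewrite size_map_poly_id0 //; apply: contraNneq Qlp => sp.
    have /eq_leq/size1_polyC p_c := sp.
    by rewrite lead_coefE sp -p_c.
  pose phi : {rmorphism {poly B} -> k} := horner_morph (com psi xi).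
  have phiC b : phi b%:P = psi b by apply: horner_morphC.
  have phi_p : phi p = 0 by apply/eqP.
  have phiQ x : x \in (Q : pred _) -> phi x = 0.
    (* Pseudo-division by [p] leaves a remainder in [Q] smaller than [p], whose coefficients lie in
       [Q] and are killed by [psi]. *)
    move=> Qx; have eq_x := Pdiv.Idomain.divp_eq x p.
    have Qrem : x %% p \in (Q : pred _).
      have -> : x %% p = lead_coef p ^+ scalp x p *: x - x %/ p * p.
        by rewrite eq_x addrC addKr.
      by rewrite rpredB ?idealMr // -mul_polyC idealMr.
    have p0 : p != 0 by apply: contraNneq Qlp => ->; rewrite lead_coef0 idealr0.
    have phi_rem : phi (x %% p) = 0.
      rewrite /phi /= /horner_morph map_poly_eq0_coef ?horner0 // => j.
      by apply/psiQ/p_min; rewrite // ltn_modpN0.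
    have := congr1 phi eq_x.
    rewrite -mul_polyC rmorphM rmorphD rmorphM /= phi_p phi_rem mulr0 addr0.
    move/eqP; rewrite mulf_eq0 => /orP[|/eqP //].
    by rewrite phiC rmorphXn expf_eq0 (negPf psi_p) andbF.
  exists phi; split=> //; last exact: surj.
  apply: contraNneq psi_r => phi_g; have := phiQ _ Qgv.
  by rewrite rmorphB rmorphM phiC /= phi_g mul0r sub0r => /eqP;
    rewrite oppr_eq0.
have coefQ h i : h \in (Q : pred _) -> (h`_i)%:P \in (Q : pred {poly B}).
  by move=> Qh; apply: contra_notT nQ => Qhi; exists h, i.
have [i Qgi] : exists i, g`_i \notin (contraction (@polyC B) Q : pred B).
  apply: contrapT => /forallNP gQ; move/negP: Qg; apply.
  by apply: coefs_in_prime => i; have /negP := gQ i; rewrite negbK.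
have [psi [psiQ psi_b psi_surj]] := ptsB _ _ Qgi.
have /closed_nonrootP[xi g_xi] : map_poly psi g != 0.
  by apply: contraNneq psi_b => g0; rewrite -coef_map g0 coef0.
exists (horner_morph (com psi xi) : {rmorphism {poly B} -> k}); split=> //.
  move=> x Qx; rewrite /= /horner_morph map_poly_eq0_coef ?horner0 // => j.
  by apply/psiQ/coefQ.
exact: surj.
Qed.

(** * Chains of primes and finite dimension *)

Lemma prime_chain_sub (A : comNzRingType) (P : nat -> prime_idealr A) n i j :
  prime_chain P n -> (i <= j)%N -> (j <= n)%N ->
  {subset (P i : pred A) <= (P j : pred A)}.
Proof.
move=> chP /subnK <-; elim: (j - i)%N => [|m IH] le_n x //.
by move/(IH (ltnW le_n)); case: (chP (m + i)%N le_n) => Psub _; apply: Psub.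
Qed.

Lemma not_subsetP (A : comNzRingType) (P Q : pred A) :
  ~ {subset P <= Q} <-> exists2 x, x \in P & x \notin Q.
Proof.
split=> [nPQ|[x Px Qx] PQ]; last by rewrite PQ in Qx.
apply: contrapT => nex; apply: nPQ => x Px.
by apply: contra_notT nex => Qx; exists x.
Qed.

(** The bound is strict: the dimension is less than [N]. *)
Definition finite_dim (A : comNzRingType) : Prop :=
  exists N, forall P : nat -> prime_idealr A, ~ prime_chain P N.

Lemma finite_dim_field (k : fieldType) : finite_dim k.
Proof.
exists 1%N => P /(_ 0%N isT)[_ /not_subsetP[x P1x P0x]].
have x0 : x != 0 by apply: contraNneq P0x => ->; rewrite idealr0.
by have := idealMr x^-1 P1x; rewrite mulVf // idealr1.
Qed.

Lemma finite_dim_image (A B : comNzRingType) (f : {rmorphism A -> B}) :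
  (forall y, exists x, f x = y) -> finite_dim A -> finite_dim B.
Proof.
move=> f_surj [N nchA]; exists N => P chP.
apply: (nchA (fun i => contraction f (P i))) => i /chP[Psub nPsub].
split=> [x|sub]; first by rewrite !contractionE; apply: Psub.
apply: nPsub => y; have [x <-] := f_surj y.
by rewrite -!contractionE; apply: sub.
Qed.

(* Every fibre of [Spec B[X] -> Spec B] has dimension at most 1. *)
Lemma prime_poly_chain2 (B : idomainType) (Q0 Q1 Q2 : prime_idealr {poly B}) :
  {subset (Q0 : pred {poly B}) <= (Q1 : pred {poly B})} ->
  {subset (Q1 : pred {poly B}) <= (Q2 : pred {poly B})} ->
  ~ {subset (Q1 : pred {poly B}) <= (Q0 : pred {poly B})} ->
  ~ {subset (Q2 : pred {poly B}) <= (Q1 : pred {poly B})} ->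
  ~ {subset (contraction (@polyC B) Q2 : pred B) <=
            (contraction (@polyC B) Q0 : pred B)}.
Proof.
move=> Q01 Q12 /not_subsetP[h Q1h Q0h] /not_subsetP[g Q2g Q1g] Q20.
have [i Q1hi] : exists i, (h`_i)%:P \notin (Q1 : pred {poly B}).
  apply: contrapT => /forallNP hQ; move/negP: Q0h; apply.
  apply: coefs_in_prime => i; have /negP := hQ i; rewrite negbK => Q1hi.
  have := Q20 h`_i; rewrite !contractionE; apply; exact: Q12.
have [p Q1p [Q1lp p_min]] := prime_min_poly Q1h Q1hi.
have [r [v [Q1r Q1gv]]] := prime_poly_bezout Q1p Q1lp p_min Q1g.
move/negP: Q1r; apply; apply: (Q01 r%:P).
have := Q20 r; rewrite !contractionE; apply; rewrite /= -(subKr (g * v) r%:P).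
by apply: rpredB; [rewrite mulrC idealMr | apply: Q12].
Qed.

(** In a chain of length [N.*2] the primes of even index contract to a chain of length [N], strict
    because of the bound on the fibres. *)
Lemma finite_dim_poly (B : idomainType) : finite_dim B -> finite_dim {poly B}.
Proof.
move=> [N nchB]; exists N.*2 => P chP.
apply: (nchB (fun i => contraction (@polyC B) (P i.*2))) => i lt_iN.
have lt2 : (i.*2.+1 < N.*2)%N by rewrite -doubleS leq_double.
have [sub0 nsub0] := chP _ (ltnW lt2); have [sub1 nsub1] := chP _ lt2.
rewrite doubleS; split; last exact: prime_poly_chain2 sub0 sub1 nsub0 nsub1.
by move=> x; rewrite !contractionE => /sub0/sub1.
Qed.

(** [B] is [k] with one polynomial variable adjoined per generator; the three properties hold for
    [k] and pass to polynomial rings. *)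
Lemma fin_gen_cover (k : closedFieldType) (S : idomainAlgType k) :
  fin_gen_algebra S -> exists (B : idomainType) (f : {rmorphism B -> S}),
    [/\ forall y, exists x, f x = y, noetherian B, enough_points k B &
        finite_dim B].
Proof.
move=> [s gen_s].
(* An image that contains [k] and the generators is everything; in this weaker form the claim admits
   an induction on [s]. *)
suff [B [f [[fk fs] nB pB dB]]] : exists (B : idomainType) (f : {rmorphism B ->
  S}),
    [/\ (forall c : k, exists x, f x = c%:A) /\
        forall y, y \in s -> exists x, f x = y,
        noetherian B, enough_points k B & finite_dim B].
  exists B, f; split=> // y; apply/asboolP.
  apply: (gen_s [pred y | `[< exists x, f x = y >]]) => [|x /fs fx]; last first.
    exact/asboolP.
  split=> [|c u v|u v].
  - by apply/asboolP; exists 1; rewrite rmorph1.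
  - move=> /asboolP[a <-] /asboolP[b <-]; apply/asboolP.
    have [d fd] := fk c; exists (d * a + b).
    by rewrite rmorphD rmorphM fd mulr_algl.
  - move=> /asboolP[a <-] /asboolP[b <-]; apply/asboolP.
    by exists (a * b); rewrite rmorphM.
elim: s {gen_s} => [|y s [B [f [[fk fs] nB pB dB]]]].
  exists k, (in_alg S); split.
  - by split=> // c; exists c.
  - exact: noetherian_field.
  - exact: enough_points_field.
  - exact: finite_dim_field.
have com : commr_rmorph f y by move=> x; apply: mulrC.
exists {poly B}, (horner_morph com : {rmorphism {poly B} -> S}); split.
- split=> [c|z]; first by have [x <-] := fk c; exists x%:P;
  rewrite /= horner_morphC.
  rewrite inE => /predU1P[->|/fs[x <-]].
    by exists 'X; rewrite /= horner_morphX.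
  by exists x%:P; rewrite /= horner_morphC.
- exact: noetherian_poly.
- exact: enough_points_poly.
- exact: finite_dim_poly.
Qed.

Section FinGen.
Variables (k : closedFieldType) (S : idomainAlgType k).
Hypothesis finS : fin_gen_algebra S.

Lemma fin_gen_noetherian : noetherian S.
Proof. by have [B [f [fs /noetherian_image n _ _]]] := fin_gen_cover finS;
  apply: n fs. Qed.

Lemma fin_gen_finite_dim : finite_dim S.
Proof. by have [B [f [fs _ _ /finite_dim_image d]]] := fin_gen_cover finS;
  apply: d fs. Qed.

(** A point of [B] that kills the preimage of [q] but not a chosen preimage of [b] factors through
    [S]; its kernel there is the maximal ideal. *)
Lemma fin_gen_jacobson (q : prime_idealr S) b : b \notin (q : pred S) ->
  exists n : prime_idealr S, [/\ maximal_ideal n,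
    {subset (q : pred S) <= (n : pred S)} & b \notin (n : pred S)].
Proof.
have [B [f [f_surj _ pts _]]] := fin_gen_cover finS.
have [b0 <-] := f_surj b; rewrite -contractionE => qb.
have [psi [psiQ psi_b psi_surj]] := pts _ _ qb.
have ker_psi x : f x = 0 -> psi x = 0.
  by move=> fx; apply: psiQ; rewrite contractionE fx idealr0.
have psi_eq x y : f x = f y -> psi x = psi y.
  by move=> fxy; apply/eqP;
    rewrite -subr_eq0 -rmorphB ker_psi // rmorphB fxy subrr.
have [|||n nP] := @ideal_like_prime S (fun y => exists2 x, f x = y & psi x = 0).
- split; first by exists 0; rewrite rmorph0.
  move=> a _ _ [x <- x0] [y <- y0]; have [a' <-] := f_surj a.
  by exists (a' * x + y); rewrite rmorphD rmorphM // x0 y0 mulr0 addr0.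
- move=> [x fx psi_x]; have /psi_eq := etrans fx (esym (rmorph1 f)).
  by rewrite psi_x rmorph1 => /esym/eqP; rewrite oner_eq0.
- move=> x y [z]; have [x' <-] := f_surj x; have [y' <-] := f_surj y.
  rewrite -rmorphM => /psi_eq -> /eqP; rewrite rmorphM mulf_eq0.
  by case/orP=> /eqP ?; [left; exists x' | right; exists y'].
exists n; split; first 2 last.
- by apply: contra psi_b => /nP[x /psi_eq <- ->].
- move=> J nJ y; apply/idP/idP; last exact: nJ.
  have [x <-] := f_surj y => Jx; apply/nP; exists x => //; apply/eqP.
  apply: contraT => psi_x; have [z psi_z] := psi_surj (psi x)^-1.
  have : f (z * x) + f (1 - z * x) \in (J : pred S).
    rewrite rpredD ?rmorphM ?idealMr // nJ //; apply/nP;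
      exists (1 - z * x) => //.
    by rewrite rmorphB rmorph1 rmorphM psi_z /= mulVf // subrr.
  by rewrite -rmorphD addrC subrK rmorph1 idealr1.
- move=> y; have [x <-] := f_surj y => qx; apply/nP; exists x => //.
  by apply: psiQ; rewrite contractionE.
Qed.

End FinGen.

(** * Heights, integral extensions and factorial rings *)

Section Height.
Variable A : comNzRingType.
Implicit Type q : prime_idealr A.

(** The lowest primes are dropped, so that the chain still ends at [q]. *)
Lemma height_ge_le q m n : (m <= n)%N -> height_ge q n -> height_ge q m.
Proof.
move=> le_mn [P [chP Pq]]; exists (fun i => P (i + (n - m))%N).
rewrite subnKC //; split=> // i lt_im.
by rewrite addSn; apply: chP; rewrite -{2}(subnKC le_mn) ltn_add2r.
Qed.

Lemma height_is_max q m n : height_is q n -> height_ge q m -> (m <= n)%N.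
Proof.
move=> [_ nge] ge; rewrite leqNgt; apply/negP => lt_nm.
exact/nge/(height_ge_le lt_nm).
Qed.

Lemma height_exists q : finite_dim A -> exists n, height_is q n.
Proof.
move=> [N nchA]; have [|n [nge n_min]] := @exists_min (fun n
  => ~ height_ge q n).
  by exists N => -[P [/nchA]].
case: n => [|n] in nge n_min *; first by case: nge; exists (fun=> q); split.
exists n; split=> //; apply: contrapT => /n_min.
by rewrite ltnn.
Qed.

End Height.

Lemma zero_prime (A : idomainType) :
  exists q : prime_idealr A, forall x, x \in (q : pred A) <-> x = 0.
Proof.
apply: ideal_like_prime => [||x y /eqP].
- by split=> // a x y -> ->; rewrite mulr0 addr0.
- by move/eqP; rewrite oner_eq0.
- by rewrite mulf_eq0 => /orP[]/eqP; [left|right].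
Qed.

Lemma height_ge1 (A : idomainType) (q : prime_idealr A) x :
  x \in (q : pred A) -> x != 0 -> height_ge q 1.
Proof.
move=> qx x0; have [z zP] := zero_prime A.
exists (fun i => if i == 0%N then z else q); split=> // -[|//] _ /=.
split=> [y /zP ->|]; first by rewrite idealr0.
by apply/not_subsetP; exists x => //; apply: contra x0 => /zP ->.
Qed.

(** * Integral extensions *)

Definition integral_over (A B : comNzRingType) (f : {rmorphism A -> B}) : Prop
  :=
  forall y : B, exists2 p : {poly A}, p \is monic & (map_poly f p).[y] = 0.

(** The ideal [K d] of [A] collects the elements mapped to [c] times a polynomial in [y] of degree
    below [d]. Once the chain is stationary, [c * y ^+ d] is [c] times such a polynomial, and [c]
    cancels. *)
Lemma integral_conductor (A : comNzRingType) (B : idomainType)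
    (f : {rmorphism A -> B}) (c : B) : noetherian A -> c != 0 ->
  (forall y, exists x, f x = c * y) -> integral_over f.
Proof.
move=> nA c0 cB y.
pose K d x := exists2 p : {poly A}, (size p <= d)%N &
  f x = c * (map_poly f p).[y].
have [d|d x [p sp fx]|d Kd] := @noetherian_acc A K nA.
- split; first by exists 0; rewrite ?size_poly0 // !rmorph0 horner0 mulr0.
  move=> a u v [p sp fu] [r sr fv]; exists (a%:P * p + r).
    rewrite (leq_trans (size_polyD _ _)) // geq_max sr mul_polyC.
    by rewrite (leq_trans (size_scale_leq _ _)).
  rewrite !rmorphD !rmorphM fu fv /= map_polyC hornerD hornerM hornerC mulrDr.
  by rewrite mulrCA.
- by exists p => //; apply: leqW.
have [x fx] := cB (y ^+ d).
have [|p sp] := Kd d.+1 x.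
  by exists 'X^d; rewrite ?size_polyXn // map_polyXn hornerXn.
rewrite fx => /(mulfI c0) yd; exists ('X^d - p).
  by rewrite monicE lead_coefDl ?lead_coefXn // size_polyN size_polyXn.
by rewrite rmorphB hornerD hornerN /= map_polyXn hornerXn yd subrr.
Qed.

Section Integral.
Variables (A B : comNzRingType) (f : {rmorphism A -> B}).
Hypothesis f_int : integral_over f.

(** If [x] lies in [q2] but not in [q1], the constant term of a monic relation for [x] modulo [q1]
    lies in [q2], hence in [q1]; then [x] can be cancelled, down to the relation 1 = 0. *)
Lemma integral_incomparable (q1 q2 : prime_idealr B) :
  {subset (q1 : pred B) <= (q2 : pred B)} ->
  {subset (contraction f q2 : pred A) <= (contraction f q1 : pred A)} ->
  {subset (q2 : pred B) <= (q1 : pred B)}.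
Proof.
move=> q12 q21 x q2x; case: (boolP (x \in (q1 : pred B))) => // q1x.
have [p mp px] := f_int x.
(* The induction on the monic [p] uses only this weaker form of the relation. *)
have : (map_poly f p).[x] \in (q1 : pred B) by rewrite px idealr0.
elim/poly_ind: p mp {px} => [/monic_neq0|p c IH]; first by rewrite eqxx.
rewrite rmorphD rmorphM /= map_polyX map_polyC !hornerE => mp q1p.
have q1c : f c \in (q1 : pred B).
  rewrite -contractionE; apply: q21; rewrite contractionE.
  have q2p := q12 _ q1p; rewrite -(addKr ((map_poly f p).[x] * x) (f c)).
  by rewrite rpredD ?rpredN ?idealMr.
have [p0|p0] := eqVneq p 0.
  move: mp; rewrite p0 mul0r add0r monicE lead_coefC => /eqP c1.
  by move: q1c; rewrite c1 rmorph1 idealr1.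
have : (map_poly f p).[x] * x \in (q1 : pred B).
  by rewrite -(addrK (f c) (_ * x)) rpredB.
rewrite prime_idealrM (negPf q1x) orbF; apply: IH.
move: mp; rewrite !monicE lead_coefDl ?lead_coefMX //.
by rewrite size_mulX // (leq_ltn_trans (size_polyC_leq1 _)) // ltnS lt0n
  size_poly_eq0.
Qed.

Lemma height_ge_integral (q : prime_idealr B) n :
  height_ge q n -> height_ge (contraction f q) n.
Proof.
move=> [P [chP Pq]]; exists (fun i => contraction f (P i));
  split=> [i /chP[sub nsub]|x].
  split=> [x|sub']; first by rewrite !contractionE; apply: sub.
  exact/nsub/integral_incomparable.
by rewrite !contractionE Pq.
Qed.

Hypothesis f_inj : injective f.

(* [q] is a maximal element among the ideals of [B] whose contraction lies in
   [p]; integrality forces its contraction to be all of [p]. *)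
Lemma lying_over (p : prime_idealr A) :
  exists q : prime_idealr B, contraction f q =i (p : pred A).
Proof.
pose good (X : set B) := ideal_like X /\ forall x,
  X (f x) -> x \in (p : pred A).
have good0 : good [set 0]%classic.
  split; first by split=> // a x y /= -> ->; rewrite mulr0 addr0.
  move=> x /= fx0; have -> : x = 0 by apply: f_inj; rewrite rmorph0.
  by rewrite idealr0.
have [F FG totF|Q [[Q0|[idQ Qp]] Qmax]] :=
    @Zorn_bigcup B (fun X => X = set0 \/ good X).
- have [[X FX X0]|F0] := pselect (exists2 X, F X & (X !=set0)%classic);
  last first.
    left; rewrite -subset0 => x [X FX Xx]; case: F0; exists X => //.
    by exists x.
  have goodF Y y : F Y -> Y y -> good Y.
    by move=> FY Yy; case: (FG _ FY) => // Y0; rewrite Y0 in Yy.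
  right; split; last by move=> x [Y FY Yx]; case: (goodF _ _ FY Yx) => _; apply.
  split.
    by case: X0 => x /(goodF _ _ FX)[[? _] _]; exists X.
  move=> a x y [Y FY Yx] [Z FZ Zy].
  case: (totF _ _ FY FZ) => sub.
    by exists Z => //; case: (goodF _ _ FZ Zy) => -[_ Zl] _; apply: Zl => //;
      apply: sub.
  by exists Y => //; case: (goodF _ _ FY Yx) => -[_ Zl] _; apply: Zl => //;
    apply: sub.
- case: (Qmax [set 0]%classic); last by right.
  by rewrite Q0; split=> // /(_ 0 erefl).
(* By maximality, the ideal generated by [Q] and [x] contains the image of some [t] outside [p]. *)
have ext x : ~ Q x -> exists t a b, [/\ t \notin (p : pred A),
  Q a & f t = a + b * x].
  move=> nQx; apply: contrapT => nex.
  case: (Qmax (fun u => exists a b, Q a /\ u = a + b * x)).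
    split; first by move=> u Qu; exists u, 0; rewrite mul0r addr0.
    move=> sub; apply: nQx; apply: sub; exists 0, 1; rewrite add0r mul1r.
    by case: idQ.
  right; split.
    split; first by exists 0, 0; rewrite mul0r addr0; case: idQ.
    move=> c _ _ [a [b [Qa ->]]] [a' [b' [Qa' ->]]].
    exists (c * a + a'), (c * b + b'); split; first by case: idQ => _; apply.
    by rewrite mulrDr addrACA mulrDl mulrA.
  move=> t [a [b [Qa ft]]]; case: (boolP (t \in _)) => // pt.
  by case: nex; exists t, a, b.
have Q1 : ~ Q 1 by move=> Q1; have := Qp 1; rewrite rmorph1 idealr1 => /(_ Q1).
have Qprime x y : Q (x * y) -> Q x \/ Q y.
  move=> Qxy; apply: contrapT => /not_orP[/ext[t [a [b [pt Qa ft]]]]].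
  move=> /ext[t' [a' [b' [pt' Qa' ft']]]].
  suff /Qp : Q (f (t * t')) by rewrite prime_idealrM (negPf pt) (negPf pt').
  rewrite rmorphM ft ft' mulrDl; apply: ideal_likeD => //.
    by rewrite mulrC; apply: ideal_likeM.
  rewrite mulrDr; apply: ideal_likeD => //; first exact: ideal_likeM.
  by rewrite mulrACA; apply: ideal_likeM.
have [q qQ] := ideal_like_prime idQ Q1 Qprime.
exists q => x; rewrite contractionE; apply/idP/idP => [/qQ/Qp //|px].
apply/qQ; apply: contrapT => /ext[t [a [b [pt Qa ft]]]].
have {Qa}qa : a \in (q : pred B) by apply/qQ.
have [r mr rb] := f_int b; pose n := (size r).-1.
have sr : size r = n.+1 by rewrite prednK // lt0n size_poly_eq0 monic_neq0.
(* The monic relation of [b], homogenized: since [f t] is [b * f x] modulo [q], the image of [T] is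
   [f x ^+ n] times that relation, hence 0, modulo [q]. All terms but [t ^+ n] are multiples of [x],
   so [t] would lie in [p]. *)
pose T := \sum_(i < n.+1) r`_i * (t ^+ i * x ^+ (n - i)).
have pT : T \in (p : pred A).
  apply/Qp/qQ.
  have -> : f T = \sum_(i < n.+1) f r`_i * (f t ^+ i * f x ^+ (n - i)) -
      f x ^+ n * (map_poly f r).[b].
    rewrite rb mulr0 subr0 rmorph_sum; apply: eq_bigr => i _.
    by rewrite !rmorphM !rmorphXn.
  rewrite (@horner_coef_wide _ n.+1); last by rewrite -sr size_poly.
  rewrite mulr_sumr -sumrB; apply: rpred_sum => i _; rewrite coef_map /=.
  rewrite [X in _ - X]mulrCA -mulrBr idealMr //.
  have -> : f x ^+ n = f x ^+ (n - i) * f x ^+ i.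
    by rewrite -exprD subnK // leq_ord.
  rewrite -mulrA -exprMn mulrC -mulrBr idealMr // subrXX mulrC idealMr //.
  by rewrite ft [f x * b]mulrC addrK.
suff : t ^+ n \in (p : pred A).
  elim: (n) => [|j IH]; first by rewrite idealr1.
  by rewrite exprS prime_idealrM (negPf pt).
move: pT; rewrite /T big_ord_recr /= subnn mulr1.
have -> : r`_n = 1 by move: mr; rewrite monicE lead_coefE => /eqP.
rewrite mul1r => pT;
  rewrite -(addKr (\sum_(i < n) r`_i * (t ^+ i * x ^+ (n - i))) (t ^+ n)).
rewrite rpredD // rpredN; apply: rpred_sum => i _; rewrite !idealMr //.
by rewrite -(prednK (_ : 0 < n - i)%N) ?subn_gt0 // exprS mulrC idealMr.
Qed.

End Integral.

(** * Unique factorization domains *)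

Section Ufd.
Variable S : idomainType.
Hypothesis ufdS : ufd S.

Lemma ufd_factor (x : S) : x != 0 -> exists (u : S) (s : seq S),
  [/\ u \is a GRing.unit, forall y, y \in s -> irreducible_elt y &
      x = u * \prod_(y <- s) y].
Proof.
move=> x0; case: (boolP (x \is a GRing.unit)) => ux.
  by exists x, [::]; rewrite big_nil mulr1.
have [n [a [irr_a ->]]] := ufdS.1 x x0 ux.
exists 1, (map a (index_enum 'I_n)); split; rewrite ?unitr1 ?mul1r ?big_map //.
by move=> _ /mapP[i _ ->].
Qed.

Lemma irreducible_unitM (u x : S) : u \is a GRing.unit ->
  irreducible_elt x -> irreducible_elt (u * x).
Proof.
move=> uu [x0 nux irr]; split; first by rewrite mulf_neq0 //;
  apply: contraTneq uu => ->; rewrite unitr0.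
  by rewrite unitrM uu.
move=> a b /(congr1 ( *%R u^-1)); rewrite mulKr // mulrA => /irr[|];
  last by right.
by rewrite unitrM unitrV uu; left.
Qed.

(* Unique factorization is applied to [(u * pi) * \prod r = \prod (s ++ t)]. *)
Lemma irreducible_prime (pi x y w : S) : irreducible_elt pi ->
  x * y = w * pi -> (exists z, x = z * pi) \/ exists z, y = z * pi.
Proof.
move=> irr_pi xy.
have [->|x0] := eqVneq x 0; first by left; exists 0; rewrite mul0r.
have [->|y0] := eqVneq y 0; first by right; exists 0; rewrite mul0r.
have w0 : w != 0 by apply: contraTneq (mulf_neq0 x0 y0) => w0;
  rewrite xy w0 mul0r eqxx.
have [ux [s [Ux irr_s ex]]] := ufd_factor x0.
have [uy [t [Uy irr_t ey]]] := ufd_factor y0.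
have [uw [r [Uw irr_r ew]]] := ufd_factor w0.
pose u := (ux * uy)^-1 * uw.
have Uxy : ux * uy \is a GRing.unit by rewrite unitrM Ux.
have Uu : u \is a GRing.unit by rewrite unitrM unitrV Uxy.
have irr_st z : z \in s ++ t -> irreducible_elt z.
  by rewrite mem_cat => /orP[/irr_s|/irr_t].
pose l := u * pi :: r.
have irr_l z : z \in l -> irreducible_elt z.
  by rewrite inE => /predU1P[->|/irr_r //]; apply: irreducible_unitM.
have eq_prod : \prod_(i < size l) l`_i = \prod_(j < size (s ++ t)) (s ++ t)`_j.
  have prodE (v : seq S) : \prod_(i < size v) v`_i = \prod_(z <- v) z.
    by rewrite (big_nth 0) big_mkord.
  rewrite !prodE big_cons big_cat /=; apply: (mulrI Uxy).
  have -> : ux * uy * (\prod_(i <- s) i * \prod_(i <- t) i) = w * pi.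
    by rewrite mulrACA -ex -ey.
  by rewrite /u !mulrA mulrV // mul1r ew mulrAC.
have [f [_ assoc_f]] := ufdS.2 _ _ _ _ (fun i
  => irr_l _ (mem_nth 0 (ltn_ord i)))
  (fun j => irr_st _ (mem_nth 0 (ltn_ord j))) eq_prod.
have [v Uv] := assoc_f ord0; rewrite /= => eq_pi.
set z := _`_ (f ord0) in eq_pi.
have eq_z : z = v^-1 * u * pi by rewrite -mulrA eq_pi mulKr.
have : z \in s ++ t by rewrite mem_nth.
rewrite mem_cat => /orP[zs|zt]; [left | right].
  exists (ux * \prod_(i <- rem z s) i * (v^-1 * u)).
  by rewrite ex (big_rem z) //= -[RHS]mulrA -eq_z -mulrA [z * _]mulrC.
exists (uy * \prod_(i <- rem z t) i * (v^-1 * u)).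
by rewrite ey (big_rem z) //= -[RHS]mulrA -eq_z -mulrA [z * _]mulrC.
Qed.

Lemma irreducible_prime_idealr (pi : S) : irreducible_elt pi ->
  exists q : prime_idealr S, forall x, x \in (q : pred S) <-> exists z,
    x = z * pi.
Proof.
move=> irr_pi; apply: ideal_like_prime.
- split; first by exists 0; rewrite mul0r.
  by move=> a _ _ [x ->] [y ->]; exists (a * x + y); rewrite mulrDl mulrA.
- move=> [z z1]; case: irr_pi => _ /negP + _; apply.
  by apply/unitrP; exists z; rewrite -z1 mulrC -z1.
- by move=> x y [w]; apply: irreducible_prime.
Qed.

Lemma prime_has_irreducible (q : prime_idealr S) x : x \in (q : pred S) ->
  x != 0 -> exists2 pi, pi \in (q : pred S) & irreducible_elt pi.
Proof.
move=> qx /ufd_factor[u [s [Uu irr_s ex]]].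
have nqu : u \notin (q : pred S).
  by apply/negP => /(idealMr u^-1); rewrite mulVr // idealr1.
move: qx; rewrite ex prime_idealrM (negPf nqu) /=.
elim: s irr_s {ex} => [|y s IH] irr_s; first by rewrite big_nil idealr1.
rewrite big_cons prime_idealrM => /orP[qy|]; first by exists y => //;
  apply/irr_s/mem_head.
by apply: IH => z sz; apply: irr_s; rewrite inE sz orbT.
Qed.

(** A nonzero prime inside [q] contains an irreducible element; this is a multiple of [pi], hence
    associated to it, so the prime is [q]. *)
Lemma height_irreducible (pi : S) (q : prime_idealr S) : irreducible_elt pi ->
  (forall x, x \in (q : pred S) <-> exists z, x = z * pi) -> height_is q 1.
Proof.
move=> irr_pi qP; have qpi : pi \in (q : pred S) by apply/qP; exists 1;
  rewrite mul1r.
case: (irr_pi) => pi0 _ irr; split; first exact: height_ge1 qpi pi0.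
move=> [P [chP P2]]; have [_ /not_subsetP[x P1x P0x]] := chP 0%N isT.
have [sub12 nsub21] := chP 1%N isT; apply: nsub21.
have x0 : x != 0 by apply: contraNneq P0x => ->; rewrite idealr0.
have [rho P1rho [rho0 nUrho irr_rho]] := prime_has_irreducible P1x x0.
have [w eq_rho] : exists z, rho = z * pi by apply/qP; rewrite -P2; apply: sub12.
have Uw : w \is a GRing.unit.
  by case: (irr_rho _ _ eq_rho) => // Upi; case: irr_pi => _ /negP + _.
have P1pi : pi \in (P 1%N : pred S) by rewrite -(mulKr Uw pi) -eq_rho idealMr.
by move=> y; rewrite P2 => /qP[z ->]; apply: idealMr.
Qed.

(** The irreducible factors of [b] are cancelled against [a] one at a time, until one fails to
    divide. In the second case [a / b] is outside the localization at the prime generated by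
    [pi]. *)
Lemma ufd_reduce (a b : S) : b != 0 -> (exists c, a = c * b) \/
  exists pi d a' b', [/\ irreducible_elt pi, d != 0, a = d * a',
    b = d * (b' * pi) & ~ exists z, a' = z * pi].
Proof.
move=> /ufd_factor[u [s [Uu irr_s ->]]].
elim: s irr_s a => [|y s IH] irr_s a.
  by left; exists (a * u^-1); rewrite big_nil mulr1 divrK.
rewrite big_cons; have irr_y := irr_s y (mem_head _ _).
have [[z ->]|nya] := pselect (exists z, a = z * y); last first.
  right; exists y, 1, a, (u * \prod_(i <- s) i).
  by rewrite oner_neq0 !mul1r -mulrA [y * _]mulrC.
have [w sw|[c ->]|[pi [d [a' [b' [irr_pi d0 -> eb npi]]]]]] := IH _ z.
- by apply: irr_s; rewrite inE sw orbT.
- by left; exists c; rewrite [y * _]mulrC !mulrA.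
- right; exists pi, (d * y), a', b'; split=> //.
  + by case: irr_y => y0 _ _; rewrite mulf_neq0.
  + exact: mulrAC.
  + by rewrite mulrCA eb mulrCA mulrA.
Qed.

End Ufd.

(** * Localizations of [k + I] *)

Section LocalizationMap.
Variables (A : idomainType) (p : prime_idealr A).

Lemma loc_map_subproof (a : A) : FracField.tofrac a \in local_pred p.
Proof.
by apply/local_predP; exists a, 1; rewrite idealr1 rmorph1 divr1.
Qed.

Definition loc_map (a : A) : localization p :=
  Localization (loc_map_subproof a).

Lemma loc_map_zmod : zmod_morphism loc_map.
Proof. by move=> a b; apply: val_inj; rewrite rmorphB /= rmorphB. Qed.

Lemma loc_map_monoid : monoid_morphism loc_map.
Proof.
split=> [|a b]; apply: val_inj; first by rewrite rmorph1 /= rmorph1.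
by rewrite rmorphM /= rmorphM.
Qed.

HB.instance Definition _ := GRing.isZmodMorphism.Build A (localization p)
  loc_map loc_map_zmod.
HB.instance Definition _ := GRing.isMonoidMorphism.Build A (localization p)
  loc_map loc_map_monoid.

Lemma tofrac_injective : injective (@FracField.tofrac A).
Proof. by move=> a b /eqP; rewrite tofrac_eq => /eqP. Qed.

Lemma loc_map_inj : injective loc_map.
Proof. by move=> a b /(congr1 val)/tofrac_injective. Qed.

Lemma loc_map_unit b : b \notin (p : pred A) -> exists u, u * loc_map b = 1.
Proof.
move=> pb; have pb' : (FracField.tofrac b)^-1 \in local_pred p.
  by apply/local_predP; exists 1, b; rewrite rmorph1 mul1r.
exists (Localization pb'); apply: val_inj; rewrite rmorphM rmorph1 /=.
by rewrite mulVf // (notin_prime_neq0 pb).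
Qed.

Lemma loc_map_frac z : exists a b,
  b \notin (p : pred A) /\ loc_map b * z = loc_map a.
Proof.
have /local_predP[a [b [pb ez]]] := valP z; exists a, b; split=> //.
by apply: val_inj; rewrite rmorphM /= ez mulrC divfK // (notin_prime_neq0 pb).
Qed.

Lemma loc_map_cancel (K : localization p -> Prop) b z : ideal_like K ->
  b \notin (p : pred A) -> K (loc_map b * z) -> K z.
Proof.
move=> idK /loc_map_unit[u ub] Kbz; rewrite -[z]mul1r -ub -mulrA.
exact: ideal_likeM.
Qed.

End LocalizationMap.

Section KPlusTheory.
Variables (k : fieldType) (S : idomainAlgType k) (I : idealr S).
Local Notation R := (kplus I).
Local Notation io := (kplus_incl I).

Lemma kplus_incl_inj : injective io.
Proof. exact: val_inj. Qed.

Lemma kplus_inclD r s : io (r + s) = io r + io s. Proof. by []. Qed.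

Lemma kplus_inclM r s : io (r * s) = io r * io s. Proof. by []. Qed.

Lemma kplus_of_ideal x : x \in (I : pred S) -> exists r, io r = x.
Proof.
move=> Ix; have Rx : x \in kplus_pred I.
  by apply/kplus_predP; exists 0, x; rewrite scale0r add0r.
by exists (KPlus Rx).
Qed.

Lemma kplusE r : exists c y, y \in (I : pred S) /\ io r = c%:A + y.
Proof. by have /kplus_predP := valP r. Qed.

Lemma scalar_notin (J : idealr S) c : c%:A \in (J : pred S) -> c = 0.
Proof.
move=> Jc; apply/eqP; apply: contraT => c0.
have := idealMr (c^-1)%:A Jc; rewrite -scalerAl mul1r scalerA mulVf //.
by rewrite scale1r idealr1.
Qed.

(** An element of the common ideal [I] brings all of [S] into [k + I]. *)
Lemma ideal_io_sub (r : R) x : io r \in (I : pred S) ->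
  exists t, io t = io r * x.
Proof. by move=> Ir; apply: kplus_of_ideal; rewrite mulrC idealMr. Qed.

(** The quotient of [k + I] by [I] is [k], so [I] is maximal and is the only prime containing it. *)
Lemma kplus_prime_top (p : prime_idealr R) :
  (forall r, io r \in (I : pred S) -> r \in (p : pred R)) ->
  forall r, (r \in (p : pred R)) = (io r \in (I : pred S)).
Proof.
move=> Ip r; apply/idP/idP => [pr|]; last exact: Ip.
have [c [y [Iy er]]] := kplusE r.
have [s es] := kplus_of_ideal Iy.
have ps : s \in (p : pred R) by apply: Ip; rewrite es.
have [c0|c0] := eqVneq c 0; first by rewrite er c0 scale0r add0r.
have : c^-1 *: (r - s) \in (p : pred R) by rewrite -mulr_algl idealMr // rpredB.
suff -> : c^-1 *: (r - s) = 1 by rewrite idealr1.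
apply: kplus_incl_inj; rewrite linearZ rmorphB rmorph1 /= es er addrK.
by rewrite scalerA mulVf // scale1r.
Qed.

Lemma contraction_top (q : prime_idealr S) r :
  {subset (I : pred S) <= (q : pred S)} ->
  (r \in (contraction io q : pred R)) = (io r \in (I : pred S)).
Proof.
by move=> Iq; apply: kplus_prime_top => s Is; rewrite contractionE Iq.
Qed.

(** The prime over [p] consists of the [s] with [r0 * s] in [p], the product being an element of
    [k + I]. *)
Lemma spec_surj_away (p : prime_idealr R) r0 : io r0 \in (I : pred S) ->
  r0 \notin (p : pred R) -> exists q : prime_idealr S, lies_over io q p.
Proof.
move=> Ir0 pr0.
have [|||q qP] := @ideal_like_prime S
    (fun s => exists2 r, io r = io r0 * s & r \in (p : pred R)).
- split; first by exists 0; rewrite ?idealr0 // rmorph0 mulr0.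
  move=> a x y [u eu pu] [v ev pv].
  have [w ew] := ideal_io_sub (a * x) Ir0.
  have [t et] := ideal_io_sub a Ir0.
  exists (w + v); first by rewrite kplus_inclD ew ev mulrDr.
  rewrite rpredD //; have : r0 * w \in (p : pred R).
    suff -> : r0 * w = t * u by rewrite idealMr.
    by apply: kplus_incl_inj; rewrite !kplus_inclM ew et eu mulrACA mulrA.
  by rewrite prime_idealrM (negPf pr0).
- move=> [r]; rewrite mulr1 => /kplus_incl_inj ->.
  by rewrite (negPf pr0).
- move=> x y [r er pr].
  have [u eu] := ideal_io_sub x Ir0; have [v ev] := ideal_io_sub y Ir0.
  have : u * v \in (p : pred R).
    suff -> : u * v = r0 * r by rewrite idealMr.
    by apply: kplus_incl_inj; rewrite !kplus_inclM eu ev er mulrACA -mulrA.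
  by rewrite prime_idealrM => /orP[]; [left; exists u | right; exists v].
exists q => r; rewrite contractionE; apply/idP/idP => [/qP[s es]|pr].
  have -> : s = r0 * r by apply: kplus_incl_inj; rewrite es kplus_inclM.
  by rewrite prime_idealrM (negPf pr0).
by apply/qP; exists (r0 * r); rewrite ?kplus_inclM // idealMr.
Qed.

(** Multiplying numerator and denominator by [r0] brings both into [k + I]. *)
Lemma same_localization_away (q : prime_idealr S) r0 :
  io r0 \in (I : pred S) -> io r0 \notin (q : pred S) ->
  same_localization io q.
Proof.
move=> Ir0 qr0 z; split=> [[a [b [qb ->]]]|/local_predP[s [t [qt ->]]]].
  by apply/local_predP; exists (io a), (io b).
have [a ea] := ideal_io_sub s Ir0; have [b eb] := ideal_io_sub t Ir0.
exists a, b; rewrite contractionE /= eb prime_idealrM negb_or qr0; split=> //.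
rewrite ea !rmorphM -mulf_div divff ?mul1r //.
exact: (notin_prime_neq0 qr0).
Qed.

(** As [r0] is a unit of [R_p], the ring [S] embeds in [R_p] by [x = (r0 * x) / r0]; the ideal is
    the contraction of [K] to [S]. *)
Lemma conductor_ideal_like (p : prime_idealr R) r0 (K : localization p -> Prop)
  :
  io r0 \in (I : pred S) -> r0 \notin (p : pred R) -> ideal_like K ->
  ideal_like (fun x => exists2 r, io r = io r0 * x & K (loc_map p r)).
Proof.
move=> Ir0 pr0 idK.
split; first by exists 0; rewrite rmorph0 ?mulr0 //; case: idK.
move=> a x y [u eu Ku] [v ev Kv].
have [w ew] := ideal_io_sub (a * x) Ir0.
have [t et] := ideal_io_sub a Ir0.
exists (w + v); first by rewrite kplus_inclD ew ev mulrDr.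
rewrite rmorphD; apply: ideal_likeD => //.
apply: (loc_map_cancel idK pr0); rewrite -rmorphM /=.
have -> : r0 * w = t * u.
  by apply: kplus_incl_inj; rewrite !kplus_inclM ew et eu mulrACA mulrA.
by rewrite rmorphM; apply: ideal_likeM.
Qed.

(** An ideal of [R_p] is generated by its contraction to [S], which is finitely generated. *)
Lemma noetherian_away (p : prime_idealr R) r0 : noetherian S ->
  io r0 \in (I : pred S) -> r0 \notin (p : pred R) ->
  noetherian (localization p).
Proof.
move=> nS Ir0 pr0; apply: fg_noetherian => J.
have idJ := idealr_ideal_like J.
have [s [sJ Js]] := noetherian_fg nS (conductor_ideal_like Ir0 pr0 idJ).
have [t [tJ st]] : exists t : seq (localization p),
    (forall z, z \in t -> z \in (J : pred _)) /\
    (forall x, x \in s -> exists2 r, io r = io r0 * x & loc_map p r \in t).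
  elim: s sJ {Js} => [|x s IH] sJ; first by exists [::].
  have [y sy|t [tJ st]] := IH; first by apply: sJ; rewrite inE sy orbT.
  have [r er Jr] := sJ x (mem_head _ _); exists (loc_map p r :: t); split.
    by move=> z; rewrite inE => /predU1P[->|/tJ].
  move=> y; rewrite inE => /predU1P[->|/st[r' er' tr']].
    by exists r; rewrite ?mem_head.
  by exists r'; rewrite // inE tr' orbT.
exists t; split=> // z Jz; have [a [b [pb ez]]] := loc_map_frac z.
have idt := span_ideal_like t.
apply: (loc_map_cancel idt pb); rewrite ez.
apply: (loc_map_cancel idt pr0); rewrite -rmorphM /=.
have [r er tr] : exists2 r, io r = io r0 * io a & span t (loc_map p r).
  apply: (span_sub (conductor_ideal_like Ir0 pr0 idt)) (Js _ _)
    => [x /st[r er tr]|].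
    by exists r => //; apply: mem_span.
  exists (r0 * a); first by rewrite kplus_inclM.
  by rewrite rmorphM idealMr //= -ez idealMr.
by rewrite -kplus_inclM in er; rewrite -(kplus_incl_inj er).
Qed.

Definition quot_map : {rmorphism S -> {ideal_quot I}} := \pi_{ideal_quot I}%qT.

Lemma quot_map_eq0 x : (quot_map x == 0) = (x \in (I : pred S)).
Proof. by rewrite -(rmorph0 quot_map) /= -Quotient.idealrBE subr0. Qed.

Lemma quot_map_surj y : exists x, quot_map x = y.
Proof. by exists (repr y); rewrite /= reprK. Qed.

Lemma quot_map_kplus r : exists c, quot_map (io r) = quot_map c%:A.
Proof.
have [c [y [Iy er]]] := kplusE r; exists c.
have /eqP quot_y : quot_map y == 0 by rewrite quot_map_eq0.
by rewrite er rmorphD quot_y addr0.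
Qed.

End KPlusTheory.

(** [f] splits into linear factors, and a prime containing their product at [x] contains one of
    them. *)
Lemma root_mod_prime (k : closedFieldType) (S : idomainAlgType k)
    (P : prime_idealr S) (f : {poly k}) x : f != 0 ->
  (map_poly (in_alg S) f).[x] \in (P : pred S) ->
  exists c : k, x - c%:A \in (P : pred S).
Proof.
move=> f0; have [s fs] := closed_field_poly_normal f.
have lf0 : lead_coef f != 0 by rewrite lead_coef_eq0.
rewrite fs map_polyZ rmorph_prod hornerZ prime_idealrM => /orP[|].
  by move/scalar_notin => lf; rewrite lf eqxx in lf0.
elim: s {fs} => [|c s IH]; first by rewrite big_nil hornerC idealr1.
rewrite big_cons hornerM prime_idealrM => /orP[|/IH //].
by rewrite rmorphB /= map_polyX map_polyC hornerXsubC; exists c.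
Qed.

Local Notation io := (kplus_incl _).

(* The ideals [K d] of [R_p] consist of the [c0 * h(x) / t] with [size h <= d],
   up to [c0 I]; their stabilization makes [x] algebraic over [k] modulo [I]. *)
Lemma not_noetherian_top (k : closedFieldType) (S : idomainAlgType k)
    (I : idealr S) (p : prime_idealr (kplus I)) :
  nonzero_ideal I -> krull_dim_ge {ideal_quot I} 1 ->
  (forall r, io r \in (I : pred S) -> r \in (p : pred _)) ->
  ~ noetherian (localization p).
Proof.
move=> [c0 Ic0 c0_neq0] [P chP] Ip nR.
have [sub01 /not_subsetP[y P1y P0y]] := chP 0%N isT.
have [x ex] := quot_map_surj y; rewrite -{}ex in P1y P0y.
set pi := quot_map I in P0y P1y.
have pE : forall r, (r \in (p : pred _)) = (io r \in (I : pred S)).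
  exact: kplus_prime_top.
have c0R s : exists r : kplus I, io r = c0 * s
  by apply: kplus_of_ideal; rewrite mulrC idealMr.
pose hx (h : {poly k}) := (map_poly (in_alg S) h).[x].
have hx_lin a h h' : hx (a *: h + h') = a%:A * hx h + hx h'.
  by rewrite /hx rmorphD /= map_polyZ hornerD hornerZ.
have algM a b : (a * b)%:A = a%:A * b%:A :> S
  by rewrite -scalerAl mul1r scalerA.
pose K d (z : localization p) :=
  exists (t : kplus I) s (h : {poly k}) (r : kplus I),
    [/\ t \notin (p : pred _),
  (size h <= d)%N /\ pi s = pi (hx h), io r = c0 * s &
  loc_map p t * z = loc_map p r].
have [d|d z [t [s [h [r [pt [sh es] er ez]]]]]|d Kd] := @noetherian_acc _ K nR.
- split.
    exists 1, 0, 0, 0; rewrite idealr1 size_poly0 /hx !rmorph0 horner0 mulr0.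
    by rewrite mulr0 rmorph0.
  move=> a z z' [t [s [h [r [pt [sh es] er ez]]]]] [t' [s' [h' [r' [pt' [sh'
    es'] er' ez']]]]].
  (* Elements of [k + I] are scalars modulo [I], so clearing denominators only multiplies [h] and
     [h'] by scalars and keeps the bound on the size. *)
  have [u [b [pb ea]]] := loc_map_frac a.
  have [ct ect] := quot_map_kplus t; have [ct' ect'] := quot_map_kplus t'.
  have [cb ecb] := quot_map_kplus b; have [cu ecu] := quot_map_kplus u.
  exists (b * t * t'), (io t' * io u * s + io b * io t * s').
  exists ((ct' * cu) *: h + (cb * ct) *: h'), (t' * u * r + b * t * r').
  split.
  + by rewrite !prime_idealrM !negb_or pt pt' pb.
  + split.
      rewrite (leq_trans (size_polyD _ _)) // geq_max.
      by rewrite !(leq_trans (size_scale_leq _ _)).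
    rewrite hx_lin -[_ *: h']addr0 hx_lin /hx rmorph0 horner0 addr0 -!/(hx _).
    rewrite !algM !rmorphD !rmorphM [pi (io t')]ect' [pi (io u)]ecu.
    by rewrite [pi (io b)]ecb [pi (io t)]ect es es'.
  + by rewrite kplus_inclD !kplus_inclM er er' mulrDr !(mulrCA c0).
  + rewrite mulrDr rmorphD !rmorphM /= -ea -ez -ez' -!mulrA; congr (_ + _).
    rewrite !mulrA; congr (_ * _); rewrite -!mulrA [RHS]mulrC -!mulrA.
    by congr (_ * _); rewrite [RHS]mulrC mulrA.
- by exists t, s, h, r; split=> //; split=> //; apply: leqW.
(* Stationarity is applied to [c0 * x ^+ d]: after cancelling [c0], the product of [t] and [x ^+ d]
   is a polynomial in [x] of degree below [d] modulo [I], and [t] is a nonzero scalar [c] modulo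
   [I]. *)
have [r er] := c0R (x ^+ d).
have [|t [s [h [r' [pt [sh es] er' ez]]]]] := Kd d.+1 (loc_map p r).
  exists 1, (x ^+ d), 'X^d, r; rewrite idealr1 size_polyXn rmorph1 mul1r.
  by split=> //; split=> //; rewrite /hx map_polyXn hornerXn.
rewrite -rmorphM /= in ez; have /(congr1 io) := loc_map_inj ez.
rewrite kplus_inclM er' er mulrCA => /(mulfI c0_neq0) es'.
have [c ec] := quot_map_kplus t.
have c_neq0 : c != 0.
  apply: contra pt => /eqP c0'; rewrite pE -quot_map_eq0.
  by rewrite [quot_map _ _]ec c0' scale0r rmorph0.
have [||a P0a] := @root_mod_prime k S (contraction pi (P 0%N)) (c *: 'X^d + - h)
  x.
- rewrite -size_poly_gt0 size_polyDl ?size_scale ?size_polyXn //.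
  by rewrite size_polyN ltnS.
- rewrite contractionE -/(hx _) hx_lin /hx rmorphN hornerN -/(hx h).
  rewrite map_polyXn hornerXn rmorphB rmorphM -[pi c%:A]ec -rmorphM [io t *
    _]es' es subrr.
  exact: idealr0.
(* Both [x] and [x - a] lie in [P 1], so the scalar [a] does too and vanishes; then [x] lies in
   [P 0], against its choice. *)
have a0 : a = 0.
  apply: (@scalar_notin k S (contraction pi (P 1%N))).
  rewrite -(subKr x a%:A) rpredB // contractionE; apply: sub01.
  by move: P0a; rewrite contractionE.
by move: P0a; rewrite a0 scale0r subr0 contractionE (negPf P0y).
Qed.

(** * Depictions of [k + I] *)

Section Depictions.
Variables (k : closedFieldType) (S : idomainAlgType k) (I : idealr S).
Hypotheses (finS : fin_gen_algebra S) (I_neq0 : nonzero_ideal I).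
Hypothesis dimSI : krull_dim_ge {ideal_quot I} 1%N.
Local Notation R := (kplus I).
Local Notation io := (kplus_incl I).

(** An element of [P 1] outside [P 0] is no scalar, because a scalar in a proper ideal is 0. *)
Lemma exists_nonscalar : exists x, forall c : k,
  quot_map I x <> quot_map I c%:A.
Proof.
have [P chP] := dimSI; have [_ /not_subsetP[y P1y P0y]] := chP 0%N isT.
have [x ex] := quot_map_surj y; exists x => c; rewrite ex => eq_y.
have c0 : c = 0.
  by apply: (@scalar_notin k S (contraction (quot_map I) (P 1%N)));
     rewrite contractionE -eq_y.
by move: P0y; rewrite eq_y c0 scale0r rmorph0 idealr0.
Qed.

Lemma prime_over_ideal :
  exists q : prime_idealr S, {subset (I : pred S) <= (q : pred S)}.
Proof.
have [P _] := dimSI; exists (contraction (quot_map I) (P 0%N)) => x.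
by rewrite -quot_map_eq0 contractionE => /eqP ->; rewrite idealr0.
Qed.

Lemma prime_kplusP (P : pred R) :
  (exists r, io r \in (I : pred S) /\ r \notin P) \/
  (forall r, io r \in (I : pred S) -> r \in P).
Proof.
have [|nr] := pselect (exists r, io r \in (I : pred S) /\ r \notin P);
  first by left.
by right=> r Ir; apply: contra_notT nr => Pr; exists r.
Qed.

Lemma nonzero_kplus : exists2 r : R, io r \in (I : pred S) & r != 0.
Proof.
have [x Ix x0] := I_neq0; have [r er] := kplus_of_ideal Ix.
exists r; rewrite ?er //; apply: contraNneq x0 => r0.
by rewrite -er r0.
Qed.

(** If a nonscalar [x] modulo [I] were [a / b] with [a], [b] in [k + I] and [b] outside [I], then
    [b * x = a] would make it a scalar modulo [I]. *)
Lemma same_localization_not_top (n : prime_idealr S) :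
  (forall r, io r \in (I : pred S) -> r \in (contraction io n : pred R)) ->
  ~ same_localization io n.
Proof.
move=> In same; have [x nx] := exists_nonscalar.
have [|a [b [nb ez]]] := (same (FracField.tofrac x)).2.
  exact: loc_map_subproof.
have b0 : FracField.tofrac (io b) != 0 by apply: (@notin_prime_neq0 _ n);
  apply: nb.
have eb : io b * x = io a.
  apply/(@tofrac_injective S); rewrite rmorphM /= ez mulrC divfK //.
have [ca eca] := quot_map_kplus a; have [cb ecb] := quot_map_kplus b.
have cb0 : cb != 0.
  apply: contra nb => /eqP cb0; apply: In; rewrite -quot_map_eq0 ecb cb0.
  by rewrite scale0r rmorph0.
apply: (nx (cb^-1 * ca)).
have -> : (cb^-1 * ca)%:A = cb^-1%:A * ca%:A :> S
  by rewrite -scalerAl mul1r scalerA.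
rewrite rmorphM -eca -eb rmorphM ecb mulrA -rmorphM -scalerAl mul1r scalerA.
by rewrite mulVf // scale1r rmorph1 mul1r.
Qed.

Lemma kplus_depiction : depiction io.
Proof.
have nS := fin_gen_noetherian finS.
split=> //.
- exact: kplus_incl_inj.
- move=> p; case: (prime_kplusP p) => [[r [Ir pr]]|Ip];
  first exact: spec_surj_away Ir pr.
  have [q Iq] := prime_over_ideal; exists q => r.
  by rewrite contraction_top // (kplus_prime_top Ip).
(* Both loci consist of the maximal ideals that do not contain [I]. *)
- apply/seteqP; split=> n [maxn nP]; split=> //;
    case: (prime_kplusP (contraction io n)) => [[r [Ir nr]]|In].
  + exact: noetherian_away nS Ir nr.
  + by case: (same_localization_not_top In).
  + exact: same_localization_away Ir nr.
  + by case: (not_noetherian_top I_neq0 dimSI In).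
(* The locus is nonempty because some maximal ideal avoids a given nonzero element of [I]. *)
- have [r Ir r0] := nonzero_kplus; have [z zP] := zero_prime S.
  have zr : io r \notin (z : pred S).
    by apply: contra r0 => /zP r0; apply/eqP/kplus_incl_inj.
  have [n [maxn _ nr]] := fin_gen_jacobson finS zr.
  by exists n; split=> //; apply: (@noetherian_away _ _ _ (contraction io n) r).
Qed.

(** * Comparison with an arbitrary depiction *)

Section OtherDepiction.
Variables (S' : idomainAlgType k) (iota : {lrmorphism R -> S'}).
Hypothesis depS' : depiction iota.

(* A maximal ideal [n] above [q'] avoiding [iota r0] lies in the noetherian
   locus, hence in U, so that S' is contained in [R_(n /\ R)]. *)
Lemma depiction_frac (q' : prime_idealr S') r0 : io r0 \in (I : pred S) ->
  iota r0 \notin (q' : pred S') -> forall s, exists a b,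
    iota b \notin (q' : pred S') /\ iota b * s = iota a.
Proof.
move=> Ir0 qr0 s; case: depS' => _ finS' _ eqU _.
have [n [maxn qn nr0]] := fin_gen_jacobson finS' qr0.
have [_ /(_ (FracField.tofrac s))[_ nP]] : U_locus iota n.
  rewrite eqU; split=> //.
  exact: (@noetherian_away _ _ _ (contraction iota n) r0 (fin_gen_noetherian
    finS)).
have [|a [b [nb ez]]] := nP; first exact: loc_map_subproof.
exists a, b; split; first by apply: contra nb => /qn.
apply/(@tofrac_injective S'); rewrite rmorphM /= ez mulrC divfK //.
by apply: (@notin_prime_neq0 _ n); apply: nb.
Qed.

(** Both [S] and [S'] embed in [R_p], so a chain below [q] passes through [R_p] to a chain below
    [q']. *)
Lemma height_ge_away (p : prime_idealr R) r0 (q : prime_idealr S)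
    (q' : prime_idealr S') n : io r0 \in (I : pred S) ->
  r0 \notin (p : pred R) -> lies_over io q p -> lies_over iota q' p ->
  height_ge q n -> height_ge q' n.
Proof.
move=> Ir0 pr0 qp q'p [Q [chQ Qn]].
have iota_inj : injective iota by case: depS'.
have frac := depiction_frac Ir0 (_ : iota r0 \notin (q' : pred S')).
have {}frac s : exists a b, b \notin (p : pred R) /\ iota b * s = iota a.
  have [|a [b [qb eb]]] := frac _ s; first by rewrite -contractionE q'p.
  by exists a, b; rewrite -q'p contractionE.
have Qp i r : (i <= n)%N -> r \notin (p : pred R) -> io r \notin (Q i : pred S).
  move=> le_in; apply: contra => /(prime_chain_sub chQ le_in (leqnn n)).
  by rewrite Qn -qp.
(* [Q i] is extended to [R_p] and contracted to [S']; an index beyond [n] gets the arbitrary value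
   [q']. *)
have lift i : exists P : prime_idealr S', (i <= n)%N -> forall s,
    s \in (P : pred S') <-> exists a b, [/\ b \notin (p : pred R),
      iota b * s = iota a & io a \in (Q i : pred S)].
  have [le_in|lt_ni] := leqP i n; last by exists q'.
  have [|||P PP] := @ideal_like_prime S' (fun s => exists a b,
    [/\ b \notin (p : pred R), iota b * s = iota a & io a \in (Q i : pred S)]).
  - split; first by exists 0, 1; rewrite idealr1 !rmorph0 mulr0 idealr0.
    move=> c x y [a [b [pb eb Qa]]] [a' [b' [pb' eb' Qa']]].
    have [a2 [b2 [pb2 eb2]]] := frac c.
    exists (b' * (a2 * a) + b2 * b * a'), (b2 * b * b'); split.
    + by rewrite !prime_idealrM !negb_or pb pb' pb2.
    + rewrite rmorphD !rmorphM /= -eb -eb' -eb2 mulrDr -!mulrA; congr (_ + _).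
      rewrite [RHS]mulrC -!mulrA; congr (_ * _).
      rewrite [RHS]mulrCA; congr (_ * _).
      by rewrite [LHS]mulrC mulrA [_ * iota b']mulrC mulrA.
    + by rewrite kplus_inclD !kplus_inclM !(rpredD, idealMr).
  - move=> [a [b [pb + Qa]]]; rewrite mulr1 => /iota_inj eb.
    by move: (Qp i b le_in pb); rewrite eb Qa.
  - move=> x y [a [b [pb eb Qa]]].
    have [a1 [b1 [pb1 eb1]]] := frac x; have [a2 [b2 [pb2 eb2]]] := frac y.
    have : io (b * (a1 * a2)) \in (Q i : pred S).
      have -> : b * (a1 * a2) = b1 * b2 * a.
        apply: iota_inj; rewrite !rmorphM /= -eb -eb1 -eb2 [iota b1 * x *
          _]mulrACA.
        by rewrite [RHS]mulrCA.
      by rewrite kplus_inclM idealMr.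
    rewrite !kplus_inclM !prime_idealrM (negPf (Qp i b le_in pb)) /=.
    by case/orP=> ?; [left; exists a1, b1 | right; exists a2, b2].
  by exists P.
have [P PP] := choice lift; exists P; split=> [i lt_in|s].
  have le_in := ltnW lt_in; have [sub /not_subsetP[x Q1x Q0x]] := chQ i lt_in.
  split=> [s /(PP i le_in)[a [b [pb eb Qa]]]|].
    by apply/(PP i.+1 lt_in); exists a, b; split=> //; apply: sub.
  (* The factor [r0], outside [Q i], brings the separating element [x] into [k + I], and from there
     into [S']. *)
  apply/not_subsetP; have [t et] := ideal_io_sub x Ir0.
  exists (iota t).
    apply/(PP i.+1 lt_in); exists t, 1; rewrite idealr1 rmorph1 mul1r.
    by split=> //; rewrite et idealMr.
  apply/negP => /(PP i le_in)[a [b [pb + Qa]]].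
  rewrite -rmorphM /= => /iota_inj eb; move: Qa.
  rewrite -eb kplus_inclM et !prime_idealrM (negPf Q0x) orbF.
  by rewrite (negPf (Qp i b le_in pb)) (negPf (Qp i r0 le_in pr0)).
have [a [b [pb eb]]] := frac s.
have qa : (s \in (q' : pred S')) = (a \in (p : pred R)).
  rewrite -q'p contractionE /= -eb prime_idealrM.
  by rewrite -[iota b \in _]contractionE q'p (negPf pb).
rewrite qa; apply/idP/idP => [/(PP n (leqnn n))[a' [b' [pb' eb' Qa']]]|pa].
  rewrite -qa; suff : iota b' * s \in (q' : pred S').
    by rewrite prime_idealrM -[iota b' \in _]contractionE q'p (negPf pb').
  by rewrite eb' -contractionE q'p -qp contractionE -Qn.
by apply/(PP n (leqnn n)); exists a, b; split=> //;
  rewrite Qn -[_ \in _]contractionE qp.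
Qed.

Section UfdNoHeightOne.
Hypothesis ufdS : ufd S.
Hypothesis no_height1 : forall q : prime_idealr S,
  {subset (I : pred S) <= (q : pred S)} -> ~ height_is q 1.

(* [S'] lies in the localization of [S] at every height-one prime, and [S] is
   the intersection of these localizations. *)
Lemma ufd_depiction_sub r0 s' : io r0 \in (I : pred S) -> r0 != 0 ->
  exists s r, io r = io r0 * s /\ iota r = iota r0 * s'.
Proof.
move=> Ir0 r0_neq0; case: (depS') => iota_inj _ surj _ _.
have iota_eq0 r : iota r = 0 -> r = 0 by rewrite -(rmorph0 iota) => /iota_inj.
have [z zP] := zero_prime S'.
have [|a [b [zb eb]]] := @depiction_frac z r0 Ir0 _ s'.
  by apply: contra r0_neq0 => /zP/iota_eq0 ->.
have ib0 : iota b != 0 by apply: contra zb => /eqP/zP.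
have b0 : io b != 0.
  by apply: contra ib0 => /eqP b0;
    rewrite (kplus_incl_inj (b0 : io b = io 0)) rmorph0.
have [[s es]|[pi [d [a' [b' [irr_pi d0 ea eb' npi]]]]]] :=
  ufd_reduce ufdS (io a) b0.
  have [r er] := ideal_io_sub s Ir0; exists s, r; split=> //.
  apply: (mulfI ib0); rewrite mulrCA eb -!rmorphM; congr (iota _).
  by apply: kplus_incl_inj; rewrite !kplus_inclM er es mulrCA [s * _]mulrC.
have [q qP] := irreducible_prime_idealr ufdS irr_pi.
(* The prime [q] generated by [pi] has height one, so it does not contain [I]. *)
case: (prime_kplusP (contraction io q)) => [[r1 [Ir1 qr1]]|Iq]; last first.
  case: (no_height1 (q := q)); last exact: height_irreducible irr_pi qP.
  by move=> x Ix; have [r er] := kplus_of_ideal Ix; move: (Iq r);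
    rewrite contractionE /= er; apply.
(* At a prime of [S'] over the contraction of [q], [s'] is also [a2 / b2] with [b2] outside [q].
   Comparison with [a / b] makes [pi] divide [io b2 * a'], although it divides neither factor. *)
have [q' q'q] := surj (contraction io q).
have [|a2 [b2 [qb2 eb2]]] := @depiction_frac q' r1 Ir1 _ s'.
  by rewrite -contractionE q'q.
have : b2 * a = b * a2.
  by apply: iota_inj; rewrite !rmorphM /= -eb -eb2 mulrCA.
move/(congr1 io); rewrite !kplus_inclM ea eb' mulrCA -[in RHS]mulrA
  => /(mulfI d0).
rewrite mulrAC => /(irreducible_prime ufdS irr_pi)[/qP qb|//].
by move: qb2; rewrite -contractionE q'q contractionE qb.
Qed.

Lemma ufd_depiction_embed : exists2 J : {rmorphism S' -> S}, injective J &
  forall r, J (iota r) = io r.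
Proof.
have [r0 Ir0 r0_neq0] := nonzero_kplus.
have iota_inj : injective iota by case: depS'.
have ir0 : iota r0 != 0.
  by apply: contra r0_neq0 => /eqP; rewrite -(rmorph0 iota) => /iota_inj ->.
have c0 : io r0 != 0.
  by apply: contra r0_neq0 => /eqP r0E; apply/eqP/kplus_incl_inj.
(* The graph of the embedding: [s'] and [s] correspond when their multiples by [r0] are the same
   element of [k + I]. *)
pose E s' s := exists r, io r = io r0 * s /\ iota r = iota r0 * s'.
have E_fun s' s t : E s' s -> E s' t -> s = t.
  move=> [r [er er']] [u [eu eu']]; apply: (mulfI c0); rewrite -er -eu.
  by congr (kplus_incl I _); apply: iota_inj; rewrite er' eu'.
have E_inj s' t' s : E s' s -> E t' s -> s' = t'.
  move=> [r [er er']] [u [eu eu']]; apply: (mulfI ir0); rewrite -er' -eu'.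
  by congr (iota _); apply: kplus_incl_inj; rewrite er eu.
have [J JE] : {J : S' -> S & forall s', E s' (J s')}.
  by apply: choice => s'; apply: ufd_depiction_sub.
have Jz : zmod_morphism J.
  move=> x y; apply: (E_fun _ _ _ (JE _)).
  have [[r [er er']] [u [eu eu']]] := (JE x, JE y); exists (r - u).
  by rewrite !rmorphB /= er eu er' eu' !mulrBr.
have Jm : monoid_morphism J.
  split; first by apply: (E_fun _ _ _ (JE _)); exists r0; rewrite !mulr1.
  move=> x y; apply: (E_fun _ _ _ (JE _)).
  have [[r [er er']] [u [eu eu']]] := (JE x, JE y).
  have [w ew] := ideal_io_sub (J x * J y) Ir0; exists w; split=> //.
  have : r0 * w = r * u.
    by apply: kplus_incl_inj; rewrite !kplus_inclM ew er eu mulrACA mulrA.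
  move/(congr1 iota); rewrite !rmorphM /= er' eu' mulrACA -mulrA.
  exact: mulfI.
exists (HB.pack_for {rmorphism S' -> S} J (GRing.isZmodMorphism.Build _ _ J Jz)
  (GRing.isMonoidMorphism.Build _ _ J Jm)) => [x y /= eq_xy|r /=].
  by apply: E_inj (JE x) _; rewrite eq_xy.
by apply: (E_fun _ _ _ (JE _)); exists (r0 * r); rewrite kplus_inclM rmorphM.
Qed.

(** A nonzero [c] in [I] carries [S] into [k + I], hence into the noetherian ring [S'], so [S] is
    integral over [S']. A prime over [q'] contains [I], and its chains contract to strict chains
    below [q']. *)
Lemma ufd_depiction_height (q' : prime_idealr S') :
  (forall r, io r \in (I : pred S) -> iota r \in (q' : pred S')) ->
  exists q : prime_idealr S, {subset (I : pred S) <= (q : pred S)} /\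
    forall n, height_ge q n -> height_ge q' n.
Proof.
move=> Iq'; have [J J_inj J_iota] := ufd_depiction_embed.
have [_ finS' _ _ _] := depS'; have [c Ic c0] := I_neq0.
have J_int : integral_over J.
  apply: (integral_conductor (fin_gen_noetherian finS') c0) => y.
  have [|r er] := @kplus_of_ideal k S I (c * y); first by rewrite mulrC idealMr.
  by exists (iota r); rewrite J_iota.
have [q qq'] := lying_over J_int J_inj q'; exists q; split.
  move=> x Ix; have [r er] := kplus_of_ideal Ix.
  by rewrite -er -J_iota -contractionE qq' Iq' // er.
move=> n /(height_ge_integral J_int)[P [chP Pq]]; exists P; split=> // x.
by rewrite Pq.
Qed.

End UfdNoHeightOne.
End OtherDepiction.
End Depictions.

Theorem theorem4p1 (k : closedFieldType) (S : idomainAlgType k) (I : idealr S)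
    (finS : fin_gen_algebra S) (I_neq0 : nonzero_ideal I)
    (I_radical : radical_ideal I) (dimSI : krull_dim_ge {ideal_quot I} 1%N)
    (ufd_or_ht1 : ufd S \/ ideal_height_is I 1%N) :
  saturated_depiction (kplus_incl I).
Proof.
have depS := kplus_depiction finS I_neq0 dimSI; split=> // p.
have dS := fin_gen_finite_dim finS.
case: (prime_kplusP p) => [[r0 [Ir0 pr0]]|Ip].
  have [q qp] := spec_surj_away Ir0 pr0; have [n qn] := height_exists q dS.
  exists q, n; split=> //; split; first by exists S, (kplus_incl I), q.
  move=> m [S' [iota [q' [dep' q'p q'm]]]]; apply: (height_is_max q'm).
  exact: (height_ge_away finS dep' Ir0 pr0 qp q'p qn.1).
(* Over [I], the witness is a prime of least height among those containing [I]. *)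
have [|n [[q [Iq qn]] n_min]] := @exists_min (fun n
  => exists q : prime_idealr S,
    {subset (I : pred S) <= (q : pred S)} /\ height_is q n).
  have [q Iq] := prime_over_ideal dimSI; have [n qn] := height_exists q dS.
  by exists n, q.
have qp : lies_over (kplus_incl I) q p.
  by move=> r; rewrite contraction_top // (kplus_prime_top Ip).
exists q, n; split=> //; split; first by exists S, (kplus_incl I), q.
move=> m [S' [iota [q' [dep' q'p q'm]]]].
have Iq' r : kplus_incl I r \in (I : pred S) -> iota r \in (q' : pred S').
  by move/Ip; rewrite -q'p.
(* If a height-one prime contains [I], then [n] is at most 1, while [q'] contains the image of a
   nonzero element of [I] and so has height at least 1. *)
have [[q1 [Iq1 ht_q1]]|no_ht1] := pselect (exists q1 : prime_idealr S,
    {subset (I : pred S) <= (q1 : pred S)} /\ height_is q1 1).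
  apply: (@leq_trans 1); first by apply: n_min; exists q1.
  apply: (height_is_max q'm); have [r Ir r0] := nonzero_kplus I_neq0.
  apply: (height_ge1 (Iq' _ Ir)); case: dep' => iota_inj _ _ _ _.
  by apply: contra r0 => /eqP; rewrite -(rmorph0 iota) => /iota_inj ->.
case: ufd_or_ht1 => [ufdS|[[q1 ht_q1] _]]; last by case: no_ht1; exists q1.
have [|q2 [Iq2 ht_q2]] := ufd_depiction_height finS I_neq0 dep' ufdS _ Iq'.
  by move=> q1 Iq1 ht_q1; apply: no_ht1; exists q1.
have [m2 q2m2] := height_exists q2 dS.
apply: (@leq_trans m2); first by apply: n_min; exists q2.
exact/(height_is_max q'm)/ht_q2/q2m2.1.
Qed.
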